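(* Let $n$ be a positive integer with $n \notin \{1,2,3,4,5,6,8,10,12\}$ and let $d = \varphi(n)/2$, so that $\deg \Psi_n = d$ and $d \ge 3$. 1. If $d \ge 5$ is odd, then $\operatorname{Aut}\Psi_n = \{I\} \cong \mathbf{C}_1$ and $\operatorname{Aut}|\Psi_n| = \{\pm I\} \cong \mathbf{C}_2$. 2. If $d \ge 6$ is even and $n \not\equiv 0 \pmod 4$, then $\operatorname{Aut}\Psi_n = \operatorname{Aut}|\Psi_n| = \{\pm I\} \cong \mathbf{C}_2$. 3. If $n \equiv 0 \pmod 4$ and $n \ne 24$, then $$\operatorname{Aut}\Psi_n = \operatorname{Aut}|\Psi_n| = \left\langle \begin{pmatrix}-1&0\\0&1\end{pmatrix}, \begin{pmatrix}1&0\\0&-1\end{pmatrix}\right\rangle \cong \mathbf{D}_2.$$ 4. If $n \in \{7,9,14,15,18,24,30\}$, then: (a) for $n \in \{7,18\}$: $\operatorname{Aut}\Psi_n = \left\langle \begin{pmatrix}-1&-1\\1&0\end{pmatrix}\right\rangle$, which is $\operatorname{GL}_2(\mathbb{Q})$-conjugate to $\mathbf{C}_3$, and $\operatorname{Aut}|\Psi_n| = \left\langle \begin{pmatrix}-1&-1\\1&0\end{pmatrix}, \begin{pmatrix}-1&0\\0&-1\end{pmatrix}\right\rangle$, which is $\operatorname{GL}_2(\mathbb{Q})$-conjugate to $\mathbf{D}_3$; (b) for $n \in \{9,14\}$: $\operatorname{Aut}\Psi_n = \left\langle \begin{pmatrix}-1&1\\-1&0\end{pmatrix}\right\rangle$,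 which is $\operatorname{GL}_2(\mathbb{Q})$-conjugate to $\mathbf{C}_3$, and $\operatorname{Aut}|\Psi_n| = \left\langle \begin{pmatrix}-1&1\\-1&0\end{pmatrix}, \begin{pmatrix}-1&0\\0&-1\end{pmatrix}\right\rangle$, which is $\operatorname{GL}_2(\mathbb{Q})$-conjugate to $\mathbf{D}_3$; (c) for $n = 15$: $\operatorname{Aut}\Psi_{15} = \operatorname{Aut}|\Psi_{15}| = \left\langle \begin{pmatrix}-1&2\\-1&1\end{pmatrix}\right\rangle$, which is $\operatorname{GL}_2(\mathbb{Q})$-conjugate to $\mathbf{C}_4$; (d) for $n = 24$: $\operatorname{Aut}\Psi_{24} = \operatorname{Aut}|\Psi_{24}| = \left\langle \begin{pmatrix}0&1\\1&0\end{pmatrix}, \begin{pmatrix}0&1\\-1&0\end{pmatrix}\right\rangle = \mathbf{D}_4$; (e) for $n = 30$: $\operatorname{Aut}\Psi_{30} = \operatorname{Aut}|\Psi_{30}| = \left\langle \begin{pmatrix}1&2\\-1&-1\end{pmatrix}\right\rangle$, which is $\operatorname{GL}_2(\mathbb{Q})$-conjugate to $\mathbf{C}_4$.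
   Context: $\varphi$ is Euler's totient function and $I$ is the $2\times 2$ identity matrix. $\Psi_n(x)$ denotes the minimal polynomial over $\mathbb{Q}$ of $2\cos(2\pi/n)$, and $\Psi_n(x,y)$ (also written $\Psi_n$) is its homogenization; for $n \ge 3$, $\Psi_n(x,y) = \prod_{1 \le k < n/2,\ \gcd(k,n)=1}\left(x - 2\cos\left(\frac{2\pi k}{n}\right)y\right)$. For a binary form $F(x,y)$ and a matrix $M = \begin{pmatrix}s&u\\t&v\end{pmatrix}$ put $F_M(x,y) = F(sx+uy,\, tx+vy)$. $\operatorname{Aut} F$ is the group of all $2\times2$ matrices $M$ with rational entries such that $F_M = F$, and $\operatorname{Aut}|F|$ is the group of all $2\times 2$ matrices $M$ with rational entries such that $F_M = F$ or $F_M = -F$. The following finite subgroups of $\operatorname{GL}_2(\mathbb{Q})$ are fixed: $\mathbf{C}_1 = \{I\}$, $\mathbf{C}_2 = \{\pm I\}$, $\mathbf{C}_3 = \left\langle\begin{pmatrix}0&1\\-1&-1\end{pmatrix}\right\rangle$, $\mathbf{C}_4 = \left\langle\begin{pmatrix}0&1\\-1&0\end{pmatrix}\right\rangle$, $\mathbf{D}_2 = \left\langle\begin{pmatrix}0&1\\1&0\end{pmatrix}, \begin{pmatrix}-1&0\\0&-1\end{pmatrix}\right\rangle$, $\mathbf{D}_3 = \left\langle\begin{pmatrix}0&1\\1&0\end{pmatrix}, \begin{pmatrix}0&1\\-1&-1\end{pmatrix}\right\rangle$, $\mathbf{D}_4 = \left\langle\begin{pmatrix}0&1\\1&0\end{pmatrix},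 \begin{pmatrix}0&1\\-1&0\end{pmatrix}\right\rangle$.
   Formalization: In 4(a) and 4(b), Aut|Ψ_n| = ⟨A, −I⟩ is cyclic of order 6, so it cannot be conjugate to the nonabelian D_3; the formal theorem instead proves it is GL_2(Q)-conjugate to the cyclic group of order 6 generated by (0 −1; 1 1). *)

(* Defs.v *)
From HB Require Import structures.
From mathcomp Require Import all_boot all_order all_algebra.
From mathcomp Require Import mpoly.
From mathcomp Require Import boolp classical_sets functions reals trigo.

Set Implicit Arguments.
Unset Strict Implicit.
Unset Printing Implicit Defensive.

Import Order.TTheory GRing.Theory Num.Theory.

Local Open Scope classical_set_scope.
Local Open Scope ring_scope.

Definition is_minpoly (R : realType) (a : R) (p : {poly rat}) : Prop :=
  [/\ p \is monic,
      root (map_poly ratr p) a &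
      forall q : {poly rat},
        q != 0 -> root (map_poly ratr q) a -> (size p <= size q)%N].

(* The default value 0 of [xget] is never taken for n > 0, since
   2 cos (2 pi / n) is algebraic. *)
Definition Psi (R : realType) (n : nat) : {poly rat} :=
  xget 0 [set p | is_minpoly (2 * cos (2 * pi / n%:R) : R) p].

Definition var_x : {mpoly rat[2]} := 'X_(0 : 'I_2).
Definition var_y : {mpoly rat[2]} := 'X_(1 : 'I_2).

Definition homogenize (p : {poly rat}) : {mpoly rat[2]} :=
  \sum_(i < size p) p`_i *: (var_x ^+ i * var_y ^+ ((size p).-1 - i)).

Definition PsiForm (R : realType) (n : nat) : {mpoly rat[2]} :=
  homogenize (Psi R n).

(* F_M(x, y) = F(s x + u y, t x + v y) for M = (s, u; t, v). *)
Definition form_act (F : {mpoly rat[2]}) (M : 'M[rat]_2) : {mpoly rat[2]} :=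
  F \mPo [tuple M 0 0 *: var_x + M 0 1 *: var_y;
                M 1 0 *: var_x + M 1 1 *: var_y].

Definition Aut (F : {mpoly rat[2]}) : set 'M[rat]_2 :=
  [set M | form_act F M = F].

Definition AutAbs (F : {mpoly rat[2]}) : set 'M[rat]_2 :=
  [set M | form_act F M = F \/ form_act F M = - F].

Definition subgroup_GL2 (H : set 'M[rat]_2) : Prop :=
  [/\ H `<=` [set M | M \in unitmx],
      H 1%:M,
      forall M N, H M -> H N -> H (M *m N) &
      forall M, H M -> H (invmx M)].

(* Meaningful only for sets S of invertible matrices. *)
Definition generated (S : set 'M[rat]_2) : set 'M[rat]_2 :=
  smallest subgroup_GL2 S.

Definition isomorphic (H K : set 'M[rat]_2) : Prop :=
  exists f : 'M[rat]_2 -> 'M[rat]_2,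
    set_bij H K f /\
    (forall M N, H M -> H N -> f (M *m N) = f M *m f N).

Definition conjugate_GL2 (H K : set 'M[rat]_2) : Prop :=
  exists2 P : 'M[rat]_2,
    P \in unitmx & H = [set invmx P *m M *m P | M in K].

Definition mx2 (a b c d : rat) : 'M[rat]_2 :=
  \matrix_(i, j) if i == 0 then (if j == 0 then a else b)
                 else (if j == 0 then c else d).

Definition C1 : set 'M[rat]_2 := [set 1%:M].
Definition C2 : set 'M[rat]_2 := [set 1%:M; - 1%:M].
Definition C3 : set 'M[rat]_2 := generated [set mx2 0 1 (-1) (-1)].
Definition C4 : set 'M[rat]_2 := generated [set mx2 0 1 (-1) 0].
(* Cyclic of order 6. The group <A, -I> with A of order 3 is cyclic of order 6,
   so it is conjugate to C6 and not to the nonabelian group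
   D3 = <(0, 1; 1, 0), (0, 1; -1, -1)>, which the source names instead. *)
Definition C6 : set 'M[rat]_2 := generated [set mx2 0 (-1) 1 1].
Definition D2 : set 'M[rat]_2 :=
  generated [set mx2 0 1 1 0; mx2 (-1) 0 0 (-1)].
Definition D4 : set 'M[rat]_2 :=
  generated [set mx2 0 1 1 0; mx2 0 1 (-1) 0].

(* Main.v *)
Require Import Defs.
From HB Require Import structures.
From mathcomp Require Import all_boot all_order all_algebra all_field.
From mathcomp Require Import mpoly.
From mathcomp Require Import complex.
From mathcomp Require Import boolp classical_sets functions reals trigo.
From mathcomp Require Import ring lra zify.

(** Let [z] be a primitive [n]-th root of unity, [theta_k = z^k + z^-k] and
    [d] half the totient of [n].  The polynomial Psi_n is characterized by
    X^d Psi_n(X + 1/X) = Phi_n ([is_psi]).  Through this identity the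
    irreducibility of Phi_n says that a root of Psi_n satisfies no nonzero
    rational polynomial of degree less than [d], and the real number
    2 cos (2 pi / n) can be traded for [theta_1] in the algebraic numbers.

    Let [M = (s, u; t, v)] be rational with F_M = F or F_M = - F, where F is the
    form of Psi_n.  Then [M] permutes the roots of Psi_n as a Moebius
    transformation, so that
    [theta_k (t theta_1 + v) = s theta_1 + u] for some [k] prime to [n]
    ([AutAbs_mobius_maps]).  Since
    [theta_1 theta_k = theta_(k+1) + theta_(k-1)], this is a rational linear
    relation between the powers of [z] with exponents [+-(k+1)], [+-(k-1)],
    [+-k], [+-1] and 0.  Let [p] be a prime factor of [n].  The conjugations
    [z -> z w^l] with [w^p = 1] multiply the term of exponent [i] by [w^(il)], so
    a discrete Fourier transform separates the exponents by their residue modulo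
    [p]: the partial sums over the residue classes all vanish if [p^2] divides
    [n] or if some class contains no exponent ([residue_part_eq0]), and they are
    all equal, after replacing [z] by a root of order [n/p], if [p] divides [n]
    only once ([residue_part_exact]).  An exponent that is alone in its class
    then has a zero coefficient.  This argument, applied to a prime [p >= 7], to
    [p = 5] if 25 divides [n], to [p = 3] if 9 divides [n], and to [p = 2]
    followed by the other primes if 4 divides [n], gives [t = u = 0] for all but
    finitely many [n] ([mobius_rel_trivial]).  So [M] is diagonal, its entries
    are 1 or -1 by comparison of the extreme coefficients of F, and the entries
    can differ only if [- theta_1] is a root of Psi_n, that is, if 4 divides [n].

    For the remaining [n] the degree is 3 or 4 and Psi_n is explicit.  An
    automorphism is determined up to sign by the image of one root
    ([mobius_maps_uniq]), because a Moebius transformation that fixes a number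
    of degree greater than 2 is the identity.  So it suffices to list the
    conjugates of a root [x]: they are Moebius images of [x] under explicit
    automorphisms, except that for [n] = 15 and 30 two of the four conjugates
    are no rational Moebius image of [x] at all. *)

Import Order.TTheory GRing.Theory Num.Theory.

Set Implicit Arguments.
Unset Strict Implicit.
Unset Printing Implicit Defensive.

Local Open Scope classical_set_scope.
Local Open Scope ring_scope.

(** * Cyclotomic polynomials and polynomials in X + 1/X *)

Definition cyclotomicQ n : {poly rat} := map_poly intr 'Phi_n.

Lemma map_cyclotomicQ (F : numFieldType) n :
  map_poly ratr (cyclotomicQ n) = map_poly intr 'Phi_n :> {poly F}.
Proof. by rewrite -map_poly_comp; apply: eq_map_poly => i /=; rewrite ratr_int. Qed.

Lemma cyclotomicQ_monic n : cyclotomicQ n \is monic.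
Proof. by rewrite monic_map // Cyclotomic_monic. Qed.

Lemma size_cyclotomicQ n : size (cyclotomicQ n) = (totient n).+1.
Proof. by rewrite size_map_poly_id0 ?size_Cyclotomic // (monicP (Cyclotomic_monic n)) oner_eq0. Qed.

(** The irreducibility of Phi_n over the rationals, in the form in which it is
    used: Phi_n is the minimal polynomial of [z]. *)
Lemma root_dvd_cyclotomicQ n (z : algC) (q : {poly rat}) :
  n.-primitive_root z -> root (map_poly ratr q) z = (cyclotomicQ n %| q).
Proof.
move=> prz; have [p [Dp mon_p ->]] := minCpolyP z.
suff -> : p = cyclotomicQ n by [].
apply: (map_poly_inj (ratr : {rmorphism rat -> algC})).
by rewrite -Dp (minCpoly_cyclotomic prz) -(Cintr_Cyclotomic prz) -map_cyclotomicQ.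
Qed.

(** X^n - 1 is the product of the Phi_d with [d] dividing [n], and a root of
    Phi_d has order at most [d].  The field is arbitrary because the complex
    numbers over an abstract real field are needed besides [algC]. *)
Lemma prim_root_cyclotomicQ (F : numFieldType) n (z : F) :
  n.-primitive_root z -> root (map_poly ratr (cyclotomicQ n)) z.
Proof.
move=> prz; have n_gt0 := prim_order_gt0 prz; rewrite map_cyclotomicQ.
have : root (map_poly intr ('X^n - 1 : {poly int})) z.
  rewrite rmorphB /= map_polyXn rmorph1 /root !hornerE ?hornerXn.
  by rewrite (prim_expr_order prz) subrr.
rewrite -prod_Cyclotomic // rmorph_prod /root horner_prod prodf_seq_eq0.
case/hasP=> d; rewrite -dvdn_divisors //= => d_dv rt_d.
suff /eqP <- : d == n by [].
rewrite eqn_dvd d_dv (prim_order_dvd prz) -subr_eq0.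
have d_gt0 : (0 < d)%N by apply: dvdn_gt0 d_dv.
have : root (map_poly intr ('X^d - 1 : {poly int})) z.
  rewrite -prod_Cyclotomic // rmorph_prod /root horner_prod prodf_seq_eq0.
  by apply/hasP; exists d => //; rewrite -dvdn_divisors.
by rewrite rmorphB /= map_polyXn rmorph1 /root !hornerE ?hornerXn.
Qed.

Lemma root_cyclotomicQ n (z : algC) :
  (0 < n)%N -> root (map_poly ratr (cyclotomicQ n)) z = n.-primitive_root z.
Proof.
move=> n_gt0; have [w prw] := C_prim_root_exists n_gt0.
by rewrite map_cyclotomicQ (Cintr_Cyclotomic prw) (root_cyclotomic prw).
Qed.

Section Reciprocal.

Variable F : fieldType.
Implicit Types (d : nat) (p f : {poly F}).

(** X^d p(X + 1/X), written without denominators. *)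
Definition self_recip d p : {poly F} :=
  \sum_(i < d.+1) p`_i *: (('X^2 + 1) ^+ i * 'X^(d - i)).

Lemma size_X2D1_exp i : size (('X^2 + 1 : {poly F}) ^+ i) = i.*2.+1.
Proof.
have s : size ('X^2 + 1 : {poly F}) = 3.
  by rewrite size_polyDl ?size_polyXn ?size_poly1.
have := size_exp ('X^2 + 1 : {poly F}) i; rewrite s /= => e.
have : size (('X^2 + 1 : {poly F}) ^+ i) != 0%N.
  by rewrite size_poly_eq0 expf_neq0 // -size_poly_eq0 s.
by case: (size _) e => //= m -> _; rewrite mul2n.
Qed.

Lemma X2D1_monic i : ('X^2 + 1 : {poly F}) ^+ i \is monic.
Proof.
rewrite monic_exp // monicE lead_coefDl ?lead_coefXn //.
by rewrite size_polyXn size_poly1.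
Qed.

Lemma self_recip_coef_lead d p : (self_recip d p)`_(d.*2) = p`_d.
Proof.
rewrite /self_recip coef_sum big_ord_recr /= big1 ?add0r => [|i _].
  rewrite subnn expr0 mulr1 coefZ.
  have /monicP := X2D1_monic d; rewrite lead_coefE size_X2D1_exp /= => ->.
  by rewrite mulr1.
rewrite coefZ coefMXn ltnNge.
have -> : (d - i <= d.*2)%N by lia.
rewrite [X in _ * X]nth_default ?mulr0 // size_X2D1_exp.
by have := ltn_ord i; lia.
Qed.

Lemma size_self_recip d p : (size (self_recip d p) <= d.*2.+1)%N.
Proof.
apply: (leq_trans (size_sum _ _ _)); apply/bigmax_leqP => i _.
apply: (leq_trans (size_scale_leq _ _)).
apply: (leq_trans (size_polyMleq _ _)); rewrite size_X2D1_exp size_polyXn /=.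
by have := ltn_ord i; lia.
Qed.

Lemma horner_self_recip d p z :
  z != 0 -> (size p <= d.+1)%N -> (self_recip d p).[z] = z ^+ d * p.[z + z^-1].
Proof.
move=> z0 sp; rewrite /self_recip horner_sum (horner_coef_wide _ sp) mulr_sumr.
apply: eq_bigr => i _; rewrite hornerZ hornerM !horner_exp hornerD horner_exp hornerX hornerC.
have -> : z ^+ 2 + 1 = z * (z + z^-1) by field.
have -> : z ^+ d = z ^+ i * z ^+ (d - i) by rewrite -exprD subnKC // -ltnS.
rewrite exprMn; move: (z ^+ i) ((z + z^-1) ^+ i) (z ^+ (d - i)) p`_i => a b c e; ring.
Qed.

Lemma X2D1_palindrome d i : (i <= d.*2)%N ->
  (('X^2 + 1 : {poly F}) ^+ d)`_i = (('X^2 + 1 : {poly F}) ^+ d)`_(d.*2 - i).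
Proof.
elim: d i => [|d IHd] i le_i; first by move: le_i; rewrite leqn0 => /eqP ->.
have z j : (d.*2 < j)%N -> (('X^2 + 1 : {poly F}) ^+ d)`_j = 0.
  by move=> lt_j; rewrite nth_default ?size_X2D1_exp.
rewrite exprSr mulrDr mulr1 !coefD !coefMXn.
move: (_ ^+ d) z IHd => q z IHd.
case: ifP => [lt_i|ge_i]; case: ifP => [lt_j|ge_j]; rewrite ?add0r.
- by congr (_`_ _); lia.
- rewrite [X in _ + X]z ?addr0; last by lia.
  by rewrite IHd; [congr (_`_ _); lia | lia].
- rewrite [X in _ + X]z ?addr0; last by lia.
  by rewrite IHd; [congr (_`_ _); lia | lia].
rewrite addrC IHd; last by lia.
rewrite [X in _ + X]IHd; last by lia.
by congr (_`_ _ + _`_ _); lia.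
Qed.

(** Subtracting a multiple of (X^2 + 1)^d from a palindromic [f] clears both ends
    of [f], and leaves X times a palindromic polynomial to which the induction
    applies. *)
Lemma palindrome_self_recip d f :
  (size f <= d.*2.+1)%N ->
  (forall i, (i <= d.*2)%N -> f`_i = f`_(d.*2 - i)) ->
  exists2 p : {poly F}, (size p <= d.+1)%N & self_recip d p = f.
Proof.
elim: d f => [|d IHd] f sf pf.
  exists f => //; rewrite /self_recip big_ord1 /= !expr0 mulr1 alg_polyC.
  by rewrite -size1_polyC.
pose g := f - f`_0 *: ('X^2 + 1) ^+ d.+1.
have palg i : (i <= d.+1.*2)%N -> g`_i = g`_(d.+1.*2 - i).
  by move=> le_i; rewrite !coefB !coefZ (pf _ le_i) (X2D1_palindrome le_i).
have g0 : g`_0 = 0.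
  have /monicP := X2D1_monic d.+1; rewrite lead_coefE size_X2D1_exp /= => e.
  by rewrite coefB coefZ X2D1_palindrome // subn0 e mulr1 subrr.
have sg : (size g <= d.+1.*2)%N.
  have sg : (size g <= d.+1.*2.+1)%N.
    apply: leq_trans (size_polyD _ _) _; rewrite geq_max sf size_polyN.
    by apply: leq_trans (size_scale_leq _ _) _; rewrite size_X2D1_exp.
  by apply/leq_sizeP => j; rewrite leq_eqVlt => /predU1P[<-|/(leq_sizeP _ _ sg)//];
    rewrite palg // subnn.
have Dg : g = drop_poly 1 g * 'X.
  rewrite -{1}(poly_take_drop 1 g) expr1 (_ : take_poly 1 g = 0) ?add0r //.
  by apply/polyP => -[|i]; rewrite coef_take_poly ?coef0.
have [||p sp Dp] := IHd (drop_poly 1 g).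
- by rewrite size_drop_poly; move: sg; lia.
- move=> i le_i; rewrite !coef_drop_poly palg; last by lia.
  by congr (_`_ _); lia.
exists (p + f`_0 *: 'X^(d.+1)).
  apply: leq_trans (size_polyD _ _) _; rewrite geq_max (leqW sp) /=.
  by apply: leq_trans (size_scale_leq _ _) _; rewrite size_polyXn.
rewrite -[f in RHS](subrK (f`_0 *: ('X^2 + 1) ^+ d.+1)) -/g Dg -Dp.
rewrite /self_recip big_ord_recr /= subnn mulr1 coefD coefZ coefXn eqxx mulr1.
rewrite (nth_default _ sp) add0r; congr (_ + _).
rewrite mulr_suml; apply: eq_bigr => i _.
rewrite coefD coefZ coefXn ltn_eqF // mulr0 addr0 -scalerAl -mulrA -exprSr.
by rewrite subSn // -ltnS.
Qed.

End Reciprocal.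

Lemma map_self_recip (F G : fieldType) (h : {rmorphism F -> G}) d p :
  map_poly h (self_recip d p) = self_recip d (map_poly h p).
Proof.
rewrite /self_recip rmorph_sum; apply: eq_bigr => i _ /=.
by rewrite map_polyZ coef_map rmorphM rmorphXn rmorphD /= rmorph1 !map_polyXn.
Qed.

Lemma prim_root_neq0 (F : fieldType) n (z : F) : n.-primitive_root z -> z != 0.
Proof.
move=> prz; have n_gt0 := prim_order_gt0 prz.
apply/eqP => z0; have := prim_expr_order prz.
by rewrite z0 expr0n eqn0Ngt n_gt0 => /eqP; rewrite eq_sym oner_eq0.
Qed.

Lemma prim_root_inv (F : fieldType) n (z : F) :
  n.-primitive_root z -> n.-primitive_root z^-1.
Proof.
move=> prz; have n_gt0 := prim_order_gt0 prz.
have -> : z^-1 = z ^+ n.-1.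
  apply: (mulfI (prim_root_neq0 prz)).
  by rewrite divff ?(prim_root_neq0 prz) // -exprS prednK // prim_expr_order.
by rewrite prim_root_exp_coprime // coprimePn.
Qed.

(** The polynomial on the left is the reversal X^N p(1/X) of [p]. *)
Lemma horner_reversal (F G : fieldType) (h : {rmorphism F -> G}) N (p : {poly F}) (w : G) :
  (size p <= N.+1)%N -> w != 0 ->
  (map_poly h (\poly_(i < N.+1) p`_(N - i))).[w]
    = w ^+ N * (map_poly h p).[w^-1].
Proof.
move=> sp w0; rewrite (@horner_coef_wide _ N.+1); last first.
  by rewrite size_map_poly size_poly.
rewrite (@horner_coef_wide _ N.+1 (map_poly _ p)); last by rewrite size_map_poly.
rewrite mulr_sumr (reindex_inj rev_ord_inj) /=; apply: eq_bigr => i _.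
rewrite !coef_map coef_poly subSS ltnS leq_subr /=.
rewrite subKn; last by rewrite -ltnS.
have -> : w ^+ N = w ^+ (N - i) * w ^+ i by rewrite -exprD subnK // -ltnS.
by rewrite mulrCA -!mulrA -exprMn divff // expr1n mulr1 mulrC.
Qed.

(** The inverse of a primitive root is primitive, so the reversal of Phi_n
    vanishes at [z] and is a multiple [c] Phi_n.  The value at 1 gives [c = 1],
    the value at -1 gives the parity of the degree; both values are nonzero
    because 1 and -1 have order at most 2. *)
Lemma cyclotomicQ_palindrome n : (2 < n)%N ->
  ~~ odd (totient n) /\
  forall i, (i <= totient n)%N -> (cyclotomicQ n)`_i = (cyclotomicQ n)`_(totient n - i).
Proof.
move=> n_gt2; have n_gt0 : (0 < n)%N by apply: ltn_trans n_gt2.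
have [z prz] := C_prim_root_exists n_gt0.
set N := totient n; pose f := \poly_(i < N.+1) (cyclotomicQ n)`_(N - i).
have horner_f (w : algC) : w != 0 ->
    (map_poly ratr f).[w] = w ^+ N * (map_poly ratr (cyclotomicQ n)).[w^-1].
  by apply: horner_reversal; rewrite size_cyclotomicQ.
have rtf : root (map_poly ratr f) z.
  have := root_cyclotomicQ (z^-1) n_gt0; rewrite (prim_root_inv prz) => /rootP r0.
  by apply/rootP; rewrite horner_f ?(prim_root_neq0 prz) // r0 mulr0.
have nz1 (w : algC) : w ^+ 2 = 1 -> (map_poly ratr (cyclotomicQ n)).[w] != 0.
  move=> w2; apply: contraTN n_gt2 => w0; rewrite -leqNgt.
  have : n.-primitive_root w by rewrite -root_cyclotomicQ.
  by move=> prw; apply: dvdn_leq => //; rewrite (prim_order_dvd prw) w2.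
have [c Df] : exists c : rat, f = c *: cyclotomicQ n.
  have : cyclotomicQ n %| f by rewrite -(root_dvd_cyclotomicQ _ prz).
  case/dvdpP => q Dq.
  have sq : (size q <= 1)%N.
    have [->|q0] := eqVneq q 0; first by rewrite size_poly0.
    have := size_poly N.+1 (fun i => (cyclotomicQ n)`_(N - i)); rewrite -/f Dq.
    rewrite size_mul // ?monic_neq0 ?cyclotomicQ_monic // size_cyclotomicQ -/N addnS /=.
    by rewrite -addn1 addnC leq_add2l.
  by exists q`_0; rewrite Dq (size1_polyC sq) mul_polyC coefC.
have c1 : c = 1.
  have := horner_f 1 (oner_neq0 _); rewrite expr1n mul1r invr1 Df map_polyZ hornerZ.
  move/eqP; rewrite -subr_eq0 -{2}[_.[1]]mul1r -mulrBl mulf_eq0.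
  rewrite (negPf (nz1 1 _)) ?expr1n // orbF subr_eq0.
  by rewrite fmorph_eq1 => /eqP.
have {c Df c1} Df : f = cyclotomicQ n by rewrite Df c1 scale1r.
split; last first.
  by move=> i le_i; rewrite -{1}Df coef_poly ltnS le_i.
have := horner_f (-1); rewrite Df oppr_eq0 oner_eq0 invrN1 => /(_ isT) /eqP.
rewrite -subr_eq0 -{1}[_.[-1]]mul1r -mulrBl mulf_eq0 (negPf (nz1 _ _)) ?sqrrN ?expr1n //.
rewrite orbF -signr_odd; case: (odd N) => //; rewrite expr1 opprK.
by rewrite -[1 + 1]/(2%:R) pnatr_eq0.
Qed.

(** If [q] has degree [e] and kills z + 1/z, then X^e q(X + 1/X) has degree [2e]
    and kills [z], so it is a multiple of Phi_n. *)
Lemma size_annihilator n (z : algC) (q : {poly rat}) : n.-primitive_root z ->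
  q != 0 -> root (map_poly ratr q) (z + z^-1) -> ((totient n)./2 < size q)%N.
Proof.
move=> prz q0 rtq; pose e := (size q).-1.
have sq : size q = e.+1 by rewrite /e prednK // lt0n size_poly_eq0.
have : cyclotomicQ n %| self_recip e q.
  rewrite -(root_dvd_cyclotomicQ _ prz) map_self_recip; apply/rootP.
  rewrite horner_self_recip ?(prim_root_neq0 prz) ?size_map_poly ?sq //.
  by rewrite (rootP rtq) mulr0.
move=> /dvdp_leq; rewrite size_cyclotomicQ => /(_ _) le.
rewrite sq ltnS; suff : (totient n <= e.*2)%N by lia.
rewrite -ltnS; apply: leq_trans (size_self_recip e q); apply: le.
apply/eqP => /(congr1 (fun p : {poly rat} => p`_(e.*2))).
rewrite self_recip_coef_lead coef0 => /eqP; apply/negP.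
by rewrite -lead_coefE lead_coef_eq0.
Qed.

(** The minimal polynomial of z + 1/z for [z] a primitive [n]-th root of unity,
    characterized without reference to a root or to the field that contains
    it. *)
Definition is_psi n (p : {poly rat}) :=
  [/\ p \is monic, size p = (totient n %/ 2).+1 &
      self_recip (totient n %/ 2) p = cyclotomicQ n].

Lemma is_psi_exists n : (2 < n)%N -> exists p, is_psi n p.
Proof.
move=> n2; have [even_phi pal] := cyclotomicQ_palindrome n2.
have e2 : (totient n %/ 2).*2 = totient n by rewrite divn2 halfK (negPf even_phi) subn0.
have [||p sp Dp] := @palindrome_self_recip rat (totient n %/ 2) (cyclotomicQ n).
- by rewrite size_cyclotomicQ e2.
- by rewrite e2.
have p1 : p`_(totient n %/ 2) = 1.
  rewrite -self_recip_coef_lead Dp e2.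
  by have /monicP := cyclotomicQ_monic n; rewrite lead_coefE size_cyclotomicQ.
have sz : size p = (totient n %/ 2).+1.
  apply/eqP; rewrite eqn_leq sp /= ltnNge; apply/negP => sz.
  by move: p1; rewrite nth_default // => /eqP; rewrite eq_sym oner_eq0.
by exists p; split=> //; rewrite monicE lead_coefE sz p1.
Qed.

(** * The real number 2 cos (2 pi / n) *)

Section RealRoot.
Variable R : realType.

Definition cis (a : R) : R[i] := Complex (cos a) (sin a).

Lemma cisX a m : cis a ^+ m = cis (a * m%:R).
Proof.
elim: m => [|m IHm]; first by rewrite expr0 mulr0 /cis cos0 sin0.
rewrite exprS IHm -natr1 mulrDr mulr1 addrC /cis cosD sinD; apply/eqP.
by rewrite eq_complex /= eqxx /= addrC eqxx.
Qed.

(** If [cos x = 1] then [sin (x / 2) = 0], which is impossible for [x] strictly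
    between 0 and [2 pi]. *)
Lemma cis_prim n : (0 < n)%N -> n.-primitive_root (cis (2 * pi / n%:R)).
Proof.
move=> n_gt0; have n0 : n%:R != 0 :> R by rewrite pnatr_eq0 -lt0n.
have c1 a : cis a = 1 -> cos a = 1 by case.
apply/andP; split=> //; apply/forallP => -[i lt_i] /=; rewrite unity_rootE.
have [->|ne_i] := eqVneq i.+1 n.
  rewrite cisX divfK // mulr_natl; apply/eqP/eqP.
  by rewrite /cis cos2pi sin2pi.
apply/eqP/negbTE/eqP; rewrite cisX => /c1; set x := _ * _.
have -> : x = (x / 2) *+ 2 by rewrite -mulr_natr divfK // pnatr_eq0.
rewrite cos_mulr2n => e.
have lt_in : (i.+1 < n)%N by rewrite ltn_neqAle ne_i.
have : 0 < sin (x / 2).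
  have -> : x / 2 = pi * (i.+1%:R / n%:R) by rewrite /x; field.
  have pi0 : 0 < pi :> R := pi_gt0 R.
  apply: sin_gt0_pi; apply/andP; split.
    by rewrite mulr_gt0 // divr_gt0 ?ltr0n.
  by rewrite gtr_pMr // ltr_pdivrMr ?mul1r ?ltr_nat // ltr0n.
have := cos2Dsin2 (x / 2); nra.
Qed.

Lemma cis_sumV a : cis a + (cis a)^-1 = Complex (2 * cos a) 0.
Proof.
have -> : (cis a)^-1 = Complex (cos a) (- sin a).
  have u : cis a * Complex (cos a) (- sin a) = 1.
    apply/eqP; rewrite eq_complex /= mulrN opprK -!expr2 cos2Dsin2 eqxx /=.
    by rewrite mulrN mulrC addNr.
  have nz : cis a != 0.
    by apply/eqP => z; move/eqP: u; rewrite z mul0r eq_sym oner_eq0.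
  by apply: (mulfI nz); rewrite divff.
by apply/eqP; rewrite eq_complex /= subrr mulr_natl mulr2n !eqxx.
Qed.

Lemma cos_root n (p : {poly rat}) : (2 < n)%N -> is_psi n p ->
  root (map_poly ratr p) (2 * cos (2 * pi / n%:R) : R).
Proof.
move=> n2 [_ sp Dp]; have n_gt0 : (0 < n)%N by apply: ltn_trans n2.
have prz := cis_prim n_gt0; have z0 := prim_root_neq0 prz.
have /rootP := prim_root_cyclotomicQ prz.
rewrite -Dp map_self_recip horner_self_recip ?size_map_poly ?sp // cis_sumV => /eqP.
rewrite mulf_eq0 expf_eq0 (negPf z0) andbF /= => /eqP rt.
set x := 2 * cos _ in rt *.
have e : map_poly ratr p = map_poly (real_complex R) (map_poly ratr p).
  by rewrite -map_poly_comp; apply: eq_map_poly => q /=; rewrite fmorph_rat.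
rewrite e (_ : Complex x 0 = real_complex R x) // horner_map in rt.
by case: rt => /eqP; rewrite /root.
Qed.

End RealRoot.

(** * Minimality, and the conjugates of 2 cos (2 pi / n) *)

Lemma psi_root n p (z : algC) : is_psi n p -> n.-primitive_root z ->
  root (map_poly ratr p) (z + z^-1).
Proof.
case=> mp sp Dp prz; have z0 := prim_root_neq0 prz.
have /rootP := prim_root_cyclotomicQ prz.
rewrite -Dp map_self_recip horner_self_recip ?size_map_poly ?sp // => /eqP.
by rewrite mulf_eq0 expf_eq0 (negPf z0) andbF.
Qed.

(** Write the root as z + 1/z with [z] algebraic: then Phi_n vanishes at [z]. *)
Lemma psi_rootP n p (r : algC) : (0 < n)%N -> is_psi n p ->
  root (map_poly ratr p) r ->
  exists2 z : algC, n.-primitive_root z & r = z + z^-1.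
Proof.
move=> n_gt0 [mp sp Dp] rt.
have [z Dz] : exists z : algC, z ^+ 2 = r * z - 1.
  have [|z] := @solve_monicpoly algC 2%N (fun i => if i == 0%N then -1 else r).
    by [].
  rewrite big_ord_recl big_ord1 /= => Dz.
  by exists z; rewrite Dz expr0 expr1 mulr1 addrC.
have z0 : z != 0.
  apply/eqP => e; move: Dz; rewrite e expr0n mulr0 add0r => /eqP.
  by rewrite eq_sym oppr_eq0 oner_eq0.
have Dr : r = z + z^-1.
  apply: (mulIf z0); rewrite mulrDl mulVf // -expr2 Dz; ring.
exists z => //; rewrite -root_cyclotomicQ // -Dp map_self_recip; apply/rootP.
by rewrite horner_self_recip ?size_map_poly ?sp // -Dr (rootP rt) mulr0.
Qed.

Lemma psi_size_root n p (q : {poly rat}) r : (0 < n)%N -> is_psi n p ->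
  root (map_poly ratr p) (r : algC) -> root (map_poly ratr q) r -> q != 0 ->
  (size p <= size q)%N.
Proof.
move=> n_gt0 psip /(psi_rootP n_gt0 psip)[z prz ->] rq q0.
by case: psip => _ -> _; rewrite divn2; apply: size_annihilator prz q0 rq.
Qed.

(** The field of the common root [r] need not contain roots of unity.  The gcd of
    [p] and [q] over the rationals is not constant, because it vanishes at [r]; if
    it were a proper factor of [p], one of the two factors of [p] would vanish at
    an algebraic z + 1/z and have too small a degree. *)
Lemma psi_size_root_num (F : numFieldType) n p (q : {poly rat}) (r : F) :
  (0 < n)%N -> is_psi n p ->
  root (map_poly ratr p) r -> root (map_poly ratr q) r -> q != 0 ->
  (size p <= size q)%N.
Proof.
move=> n_gt0 psip rp rq q0; pose g := gcdp p q.
have [z prz] := C_prim_root_exists n_gt0.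
have p0 : p != 0 by case: psip => /monic_neq0.
have rg : root (map_poly ratr g) r by rewrite gcdp_map root_gcd rp.
have g0 : g != 0 by rewrite gcdp_eq0 negb_and p0.
have sg : (1 < size g)%N.
  by rewrite -(size_map_poly (ratr : {rmorphism rat -> F})) (root_size_gt1 _ rg) // map_poly_eq0.
suff : (size p <= size g)%N by move/leq_trans; apply; rewrite dvdp_leq // dvdp_gcdr.
have /dvdpP[h Dh] : g %| p by rewrite dvdp_gcdl.
have h0 : h != 0 by apply: contraNneq p0 => e; rewrite Dh e mul0r.
have rpz := psi_root psip prz; have := rpz.
rewrite {1}Dh rmorphM rootM => /orP[rh|rgz].
  have := psi_size_root n_gt0 psip rpz rh h0.
  rewrite {1}Dh size_mul // => le_h; suff: false by [].
  by move: (size h) (size g) sg le_h => a b; lia.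
exact: psi_size_root n_gt0 psip rpz rgz g0.
Qed.

Lemma size_monic_sub (p q : {poly rat}) : p \is monic -> q \is monic ->
  size p = size q -> (size (p - q)%R < size p)%N.
Proof.
move=> mp mq sz; have sp0 : (0 < size p)%N by rewrite size_poly_gt0 monic_neq0.
rewrite -(prednK sp0) ltnS; apply/leq_sizeP => j.
rewrite -(leq_add2r 1) !addn1 (prednK sp0) leq_eqVlt coefB.
case/predU1P => [e|lt_j].
  move/monicP: mp; move/monicP: mq; rewrite !lead_coefE -sz e /= => -> ->.
  by rewrite subrr.
by rewrite !nth_default ?subrr // -?sz -ltnS // ltnW.
Qed.

Lemma is_minpoly_uniq (R : realType) (a : R) p q :
  is_minpoly a p -> is_minpoly a q -> p = q.
Proof.
move=> [mp rp minp] [mq rq minq].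
have sz : size p = size q.
  by apply/eqP; rewrite eqn_leq minp ?minq ?monic_neq0.
apply/eqP; rewrite -subr_eq0; apply: contraT => d0.
have : root (map_poly ratr (p - q)) a.
  by rewrite rmorphB /root /= !hornerE (rootP rp) (rootP rq) subrr.
by move=> /(minp _ d0); rewrite leqNgt size_monic_sub.
Qed.

Lemma is_psi_Psi (R : realType) n : (2 < n)%N -> is_psi n (Psi R n).
Proof.
move=> n2; have n_gt0 : (0 < n)%N by apply: ltn_trans n2.
have [p psip] := is_psi_exists n2.
have [mp _ _] := psip; have rp := cos_root R n2 psip.
suff -> : Psi R n = p by [].
have minp : is_minpoly (2 * cos (2 * pi / n%:R) : R) p.
  by split=> // q q0 rq; apply: psi_size_root_num n_gt0 psip rp rq q0.
apply: (@is_minpoly_uniq R (2 * cos (2 * pi / n%:R)) _ _ _ minp).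
have : exists q, [set q | is_minpoly (2 * cos (2 * pi / n%:R) : R) q] q by exists p.
by move/(xgetPex 0).
Qed.

(** * Rational relations between roots of unity *)

(** The value at [z] of a Laurent polynomial, given as a list of pairs
    (coefficient, exponent) so that terms can be selected by the residue of their
    exponent. *)
Definition root_sum (z : algC) (s : seq (rat * int)) : algC :=
  \sum_(x <- s) ratr x.1 * z ^ x.2.

Definition residue_part (p : nat) (r : int) (s : seq (rat * int)) :=
  [seq x <- s | (p %| x.2 - r)%Z].

(** The map z -> z^k extends to a field automorphism, which fixes the rational
    coefficients. *)
Lemma root_sum_conj n z s k : n.-primitive_root z -> coprime k n ->
  root_sum z s = 0 -> root_sum (z ^+ k) s = 0.
Proof.
move=> prz /Qn_aut_exists[u Du] s0.
rewrite -(Du z (prim_expr_order prz)) -(rmorph0 u) -s0 rmorph_sum.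
by apply: eq_bigr => x _; rewrite rmorphM /= fmorph_rat fmorphXz.
Qed.

Lemma prim_exprz_eq1 n (z : algC) (i : int) :
  n.-primitive_root z -> (z ^ i == 1) = (n %| i)%Z.
Proof.
move=> prz; case: i => i; first by rewrite -exprnP -(prim_order_dvd prz).
by rewrite NegzE -exprnN invr_eq1 -(prim_order_dvd prz) dvdzE abszN.
Qed.

Lemma geometric_sum p (w : algC) (i : int) : p.-primitive_root w ->
  \sum_(l < p) w ^ (i * l%:Z) = if (p %| i)%Z then p%:R else 0.
Proof.
move=> prw; under eq_bigr => l _ do rewrite -exprz_exp -exprnP.
rewrite -(prim_exprz_eq1 _ prw); case: eqP => [->|/eqP ne1].
  by under eq_bigr => l _ do rewrite expr1n; rewrite sumr_const card_ord.
have := subrX1 (w ^ i) p; rewrite exprnP exprz_exp mulrC.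
rewrite -exprz_exp -exprnP (prim_expr_order prw) exp1rz subrr => /esym/eqP.
by rewrite mulf_eq0 subr_eq0 (negPf ne1) => /eqP.
Qed.

(** Replacing [y] by [y w^l] multiplies the term of exponent [i] by [w^(il)], so an
    inverse discrete Fourier transform isolates the exponents congruent to [r]
    modulo [p]. *)
Lemma fourier_residue_part p (w y : algC) r s : p.-primitive_root w -> y != 0 ->
  \sum_(l < p) w ^ (- r * l%:Z) * root_sum (y * w ^+ l) s = p%:R * root_sum y (residue_part p r s).
Proof.
move=> prw y0; have w0 := prim_root_neq0 prw.
rewrite /root_sum big_filter mulr_sumr.
under eq_bigr => l _ do rewrite mulr_sumr.
rewrite exchange_big /= [RHS]big_mkcond; apply: eq_bigr => x _ /=.
transitivity (ratr x.1 * y ^ x.2 * \sum_(l < p) w ^ ((x.2 - r) * l%:Z)).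
  rewrite mulr_sumr; apply: eq_bigr => l _.
  rewrite expfzMl exprnP exprz_exp [l%:Z * _]mulrC.
  by rewrite mulrDl expfzDr //; ring.
rewrite geometric_sum //; case: ifP => _; last by rewrite mulr0.
by rewrite mulrC.
Qed.

(** If [p^2] divides [n], then [1 + l n/p] is prime to [n] for every [l].  So all
    the [z w^l] with [w] of order [p] are conjugates of [z], and every term of the
    Fourier sum vanishes. *)
Lemma residue_part_sq n p z s r : prime p -> (p ^ 2 %| n)%N -> n.-primitive_root z ->
  root_sum z s = 0 -> root_sum z (residue_part p r s) = 0.
Proof.
move=> pp /dvdnP[q Dn] prz s0; have p_gt0 := prime_gt0 pp.
have n_gt0 := prim_order_gt0 prz.
have prw : p.-primitive_root (z ^+ (q * p)).
  have -> : (q * p = n %/ p)%N by rewrite Dn expnS expn1 mulnA mulnK.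
  by apply: (dvdn_prim_root prz); rewrite Dn expnS expn1 mulnA dvdn_mull.
apply/eqP; have := fourier_residue_part r s prw (prim_root_neq0 prz).
rewrite big1 => [/esym/eqP|l _]; first by rewrite mulf_eq0 pnatr_eq0 eqn0Ngt p_gt0.
rewrite -exprM -exprS (root_sum_conj prz _ s0) ?mulr0 //.
have cop : coprime (q * p * l).+1 (q * p).
  by rewrite coprime_sym /coprime -addn1 [(q * p * l)%N]mulnC gcdnMDl gcdn1.
have : coprime (q * p * l).+1 ((q * p) * (q * p)) by rewrite coprimeMr cop.
apply: coprime_dvdr.
by have -> : (q * p * (q * p) = n * q)%N; [rewrite Dn; ring | rewrite dvdn_mulr].
Qed.

(** If [p] divides [n] only once, then [z] is the product of a root [y] of order
    [n/p] and a root of order [p], and the [y w^l] with [w] of order [p] are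
    conjugates of [z] except for [l = 0] modulo [p].  So only the term [l = 0] of
    the Fourier sum survives, and it does not depend on the class [r]. *)
Lemma residue_part_exact n p z : prime p -> (p %| n)%N -> ~~ (p ^ 2 %| n)%N ->
  n.-primitive_root z ->
  exists2 y, (n %/ p).-primitive_root y & forall s, root_sum z s = 0 ->
    forall r, p%:R * root_sum y (residue_part p r s) = root_sum y s.
Proof.
move=> pp /dvdnP[m Dn] np2 prz; have p_gt0 := prime_gt0 pp.
have n_gt0 := prim_order_gt0 prz.
have m_gt0 : (0 < m)%N by move: n_gt0; rewrite Dn muln_gt0 => /andP[].
have cpm : coprime p m.
  by rewrite prime_coprime //; apply: contra np2 => pm; rewrite Dn expnS expn1 dvdn_mul.
have prw : p.-primitive_root (z ^+ m).
  have -> : (m = n %/ p)%N by rewrite Dn mulnK.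
  by apply: (dvdn_prim_root prz); rewrite Dn dvdn_mull.
(* As j is 0 modulo p and 1 modulo n / p, the power z^j is the component of z of
   order n / p. *)
pose j := chinese p m 0 1.
have pj : (p %| j)%N by rewrite /dvdn /j (chinese_modl cpm 0 1) mod0n.
have jm : j = 1 %[mod m] by exact: (chinese_modr cpm 0 1).
have cjm : coprime j m by rewrite -coprime_modl jm coprime_modl coprime1n.
have gj : gcdn j n = p.
  rewrite Dn Gauss_gcdr // gcdnC; exact/gcdn_idPl.
exists (z ^+ j); first by have := exp_prim_root prz j; rewrite gj.
move=> s s0 r.
have y0 : z ^+ j != 0 by rewrite expf_neq0 // (prim_root_neq0 prz).
rewrite -(fourier_residue_part r s prw y0) -(prednK p_gt0) big_ord_recl /= mulr0 expr0z mul1r.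
rewrite expr0 mulr1 big1 ?addr0 // => i _.
rewrite -exprM -exprD (root_sum_conj prz _ s0) ?mulr0 //.
rewrite Dn coprimeMr; apply/andP; split.
  by rewrite -coprime_modl -modnDmr modnMr addn0 coprime_modl.
rewrite coprime_sym prime_coprime // dvdn_addr // Euclid_dvdM // negb_or.
rewrite -prime_coprime // cpm /=; apply/negP => /dvdn_leq.
rewrite /bump /= => /(_ isT); rewrite leqNgt => /negP; apply.
by have := ltn_ord i; rewrite add1n -ltnS prednK.
Qed.

Lemma empty_residue_part p s : (size s < p)%N -> exists r, residue_part p r s = [::].
Proof.
move=> lt_s; have p_gt0 : (0 < p)%N by apply: leq_ltn_trans lt_s.
pose t := [seq `|(x.2 %% p)%Z|%N | x <- s].
have [/allP sub|] := boolP (all (mem t) (iota 0 p)).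
  have := uniq_leq_size (iota_uniq 0 p) sub.
  by rewrite size_iota size_map leqNgt lt_s.
case/allPn=> r; rewrite mem_iota /= add0n => lt_r nr; exists r%:Z.
apply/eqP; rewrite -[_ == _]negbK -has_filter; apply: contra nr.
case/hasP => x xs; rewrite -eqz_mod_dvd => /eqP e.
by apply/mapP; exists x => //; rewrite e modz_nat absz_nat modn_small.
Qed.

(** If [p] divides [n] only once, all class sums are equal, and one of them is
    empty as there are fewer exponents than classes. *)
Lemma residue_part_eq0 n p z : prime p -> (p %| n)%N -> n.-primitive_root z ->
  exists2 y, y != 0 & forall s, root_sum z s = 0 ->
    (p ^ 2 %| n)%N || (size s < p)%N ->
    forall r, root_sum y (residue_part p r s) = 0.
Proof.
move=> pp pn prz; have [p2|np2] := boolP (p ^ 2 %| n)%N.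
  by exists z; [exact: prim_root_neq0 prz|move=> s s0 _ r; apply: residue_part_sq prz s0].
have [y pry Hy] := residue_part_exact pp pn np2 prz.
exists y; first exact: prim_root_neq0 pry.
move=> s s0 /= /empty_residue_part[r0 e0] r.
have p0 : p%:R != 0 :> algC by rewrite pnatr_eq0 -lt0n prime_gt0.
apply: (mulfI p0); rewrite mulr0 Hy // -(Hy _ s0 r0) e0.
by rewrite /root_sum big_nil mulr0.
Qed.

Lemma root_sum1 y c e : y != 0 -> root_sum y [:: (c, e)] = 0 -> c = 0.
Proof.
move=> y0; rewrite /root_sum big_seq1 => /eqP.
by rewrite mulf_eq0 fmorph_eq0 expfz_eq0 (negPf y0) andbF orbF => /eqP.
Qed.

(** Most of the case analysis below consists of finding a prime [p] modulo which
    an exponent has no companion. *)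
Lemma lone_exponent_eq0 n p z s r c e : prime p -> (p %| n)%N -> n.-primitive_root z ->
  (p ^ 2 %| n)%N || (size s < p)%N -> root_sum z s = 0 ->
  residue_part p r s = [:: (c, e)] -> c = 0.
Proof.
move=> pp pn prz h s0 Dc; have [y y0 Hy] := residue_part_eq0 pp pn prz.
by have := Hy _ s0 h r; rewrite Dc => /(root_sum1 y0).
Qed.

(** * Moebius relations between 2 cos (2 pi / n) and its conjugates *)

(** The terms of [a theta_1 theta_k + b theta_k + c theta_1 + e], where
    [theta_k = z^k + z^-k], expanded by
    [theta_1 theta_k = theta_(k+1) + theta_(k-1)]. *)
Definition mobius_rel (a b c e : rat) (k : int) : seq (rat * int) :=
  [:: (a, k + 1); (a, - (k + 1)); (a, k - 1); (a, - (k - 1));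
      (b, k); (b, - k); (c, 1); (c, - 1); (e, 0)].

(* Evaluates a residue part for a numeric modulus, when the hypothesis Dk
   determines the residue of every exponent that has to be kept or dropped. *)
Ltac classify Dk :=
  move: Dk; clear => Dk; rewrite /residue_part /=;
  repeat (let h := fresh in case: ifP => h; try (exfalso; lia); clear h); try by [].

Lemma root_sum_cons z c e s : root_sum z ((c, e) :: s) = ratr c * z ^ e + root_sum z s.
Proof. by rewrite /root_sum big_cons. Qed.

Lemma root_sum_nil z : root_sum z [::] = 0.
Proof. by rewrite /root_sum big_nil. Qed.

Definition root_sumE := (root_sum_cons, root_sum_nil, expr0z, addr0, mulr1).

Lemma root_sum_mobius_rel z a b c e k : z != 0 ->
  root_sum z (mobius_rel a b c e k) =
  ratr a * (z + z^-1) * (z ^ k + z ^ (- k)) + ratr b * (z ^ k + z ^ (- k))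
  + ratr c * (z + z^-1) + ratr e.
Proof.
move=> z0; rewrite /mobius_rel !root_sumE !opprD opprK !expfzDr // exprN1 expr1z; ring.
Qed.

Lemma root_sum_mobius_relN z a b c e k : z != 0 ->
  root_sum z (mobius_rel a b c e (- k)) = root_sum z (mobius_rel a b c e k).
Proof. by move=> z0; rewrite !root_sum_mobius_rel // opprK [z ^ (- k) + _]addrC. Qed.

(** Up to sign the differences between [k + 1] and the other exponents are
    [2 (k + 1)], 2, [2 k], 1, [2 k + 1], [k], [k + 2] and [k + 1]. *)
Lemma residue_part_mobius_rel p a b c e k : prime p -> (2 < p)%N -> ~~ (p %| k)%Z ->
  ~~ (p %| k + 1)%Z -> ~~ (p %| k + 2)%Z -> ~~ (p %| 2 * k + 1)%Z ->
  residue_part p (k + 1) (mobius_rel a b c e k) = [:: (a, k + 1)].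
Proof.
move=> pp p2 n0 n1 n2 n3.
have D2 x : (p %| 2 * x)%Z = (p %| x)%Z.
  by rewrite Gauss_dvdzr // coprimezE /= prime_coprime // gtnNdvd.
have N1 : (p %| 1)%Z = false by rewrite dvdzE /= dvdn1; case: (p) p2 => [|[|]].
have N2 : (p %| 2)%Z = false by rewrite dvdzE gtnNdvd.
rewrite /residue_part /= subrr dvdz0.
have -> : - (k + 1) - (k + 1) = - (2 * (k + 1)) by ring.
have -> : k - 1 - (k + 1) = - 2 by ring.
have -> : - (k - 1) - (k + 1) = - (2 * k) by ring.
have -> : k - (k + 1) = - 1 by ring.
have -> : - k - (k + 1) = - (2 * k + 1) by ring.
have -> : 1 - (k + 1) = - k by ring.
have -> : - 1 - (k + 1) = - (k + 2) by ring.
rewrite sub0r !dvdzE !abszN -!dvdzE !D2 N1 N2.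
by rewrite (negPf n0) (negPf n1) (negPf n2) (negPf n3).
Qed.

Section PrimitiveRoot.
Variables (n : nat) (z : algC).
Hypothesis prz : n.-primitive_root z.

(** One of the exponents [k + 1] and [k - 1] is alone modulo [p].  Otherwise [p]
    divides one of [k + 1], [k + 2], [2 k + 1] and one of [k - 1], [k - 2],
    [2 k - 1], and eliminating [k] shows that [p] divides one of 2, 3, 4 and 5.
    The bound 9 on [p] is the number of exponents. *)
Lemma mobius_rel_large p a b c e k : prime p -> (p %| n)%N -> (6 < p)%N ->
  (p ^ 2 %| n)%N || (9 < p)%N -> ~~ (p %| k)%Z ->
  root_sum z (mobius_rel a b c e k) = 0 -> a = 0.
Proof.
move=> pp pn p7 h n0 s0.
have z0 := prim_root_neq0 prz.
have N x : (p %| - x)%Z = (p %| x)%Z by rewrite !dvdzE abszN.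
have small x y m : (0 < m < 6)%N -> m%:Z = x - y -> (p %| x)%Z -> (p %| y)%Z -> False.
  move=> /andP[m0 m6] Dm px py.
  have : (p %| m%:Z)%Z by rewrite Dm rpredB.
  by rewrite dvdzE /= => /(dvdn_leq m0); lia.
have D2 x : (p %| 2 * x)%Z = (p %| x)%Z.
  by rewrite Gauss_dvdzr // coprimezE /= prime_coprime // gtnNdvd //; lia.
have [/and3P[n1 n2 n3]|] :=
    boolP [&& ~~ (p %| k + 1)%Z, ~~ (p %| k + 2)%Z & ~~ (p %| 2 * k + 1)%Z].
  by apply: (lone_exponent_eq0 (s := mobius_rel a b c e k) pp pn prz h s0
    (residue_part_mobius_rel _ _ _ _ _ _ _ _ _ _)) => //; lia.
rewrite !negb_and !negbK => /or3P bad.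
(* The relation is invariant under k -> - k, which exchanges k + 1 and - (k - 1). *)
move: s0; rewrite -root_sum_mobius_relN // => s0.
apply: (lone_exponent_eq0 (s := mobius_rel a b c e (- k)) pp pn prz h s0
  (residue_part_mobius_rel _ _ _ _ _ _ _ _ _ _)) => //; rewrite ?N //.
- by lia.
- apply/negP; rewrite -N => d; case: bad => bad.
  + by apply: (@small (k + 1) (- (- k + 1)) 2%N); rewrite //; ring.
  + by apply: (@small (k + 2) (- (- k + 1)) 3%N); rewrite //; ring.
  + by apply: (@small (2 * k + 1) (2 * (- (- k + 1))) 3%N); rewrite ?D2 //; ring.
- apply/negP; rewrite -N => d; case: bad => bad.
  + by apply: (@small (k + 1) (- (- k + 2)) 3%N); rewrite //; ring.
  + by apply: (@small (k + 2) (- (- k + 2)) 4%N); rewrite //; ring.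
  + by apply: (@small (2 * k + 1) (2 * (- (- k + 2))) 5%N); rewrite ?D2 //; ring.
- apply/negP; rewrite -N => d; case: bad => bad.
  + by apply: (@small (2 * (k + 1)) (- (2 * - k + 1)) 3%N); rewrite ?D2 //; ring.
  + by apply: (@small (2 * (k + 2)) (- (2 * - k + 1)) 5%N); rewrite ?D2 //; ring.
  + by apply: (@small (2 * k + 1) (- (2 * - k + 1)) 2%N); rewrite ?D2 //; ring.
Qed.

(** A rational root of unity is 1 or -1. *)
Lemma rational_power_dvd m (y : algC) (c c' : rat) (i : int) : m.-primitive_root y -> c != 0 ->
  ratr c * y ^ i + ratr c' = 0 -> (m %| 2 * i)%Z.
Proof.
move=> pry c0 e0; have y0 := prim_root_neq0 pry.
have [q Dq] : exists q : rat, y ^ i = ratr q.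
  exists (- c' / c); rewrite fmorph_div rmorphN /=.
  apply: (mulfI (_ : ratr c != 0 :> algC)); first by rewrite fmorph_eq0.
  by rewrite mulrCA divff ?fmorph_eq0 // mulr1; apply/eqP; rewrite -addr_eq0 e0.
rewrite -(prim_exprz_eq1 _ pry) mulrC -exprz_exp Dq -exprnP -rmorphXn fmorph_eq1.
have : q ^+ m = 1.
  apply: (fmorph_inj (ratr : {rmorphism rat -> algC})).
  rewrite rmorphXn rmorph1 /= -Dq exprnP exprz_exp mulrC -exprz_exp -exprnP.
  by rewrite (prim_expr_order pry) exp1rz.
move/(congr1 Num.norm); rewrite normrX normr1 => /eqP.
have m0 := prim_order_gt0 pry.
rewrite pexpr_eq1 // => /eqP q1.
by rewrite -[q ^+ 2]real_normK ?num_real // q1 expr1n.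
Qed.

(** For [p = 7] the exponents may meet every class.  Up to [k -> - k], the residue
    of [k] is 1, 2 or 3.  For 1, the exponent [k + 1] is alone in its class and
    another class is empty.  For 2, the classes 0, 2 and 3 make [y^k] and
    [y^(k+1)] rational; for 3, the classes 0 and 1 make [y] rational.  In both
    cases [y^2 = 1], and [n] divides 14. *)
Lemma mobius_rel_7 a b c e k : (7 %| n)%N -> ~~ (7 ^ 2 %| n)%N -> ~~ (n %| 14)%N ->
  ~~ (7%N %| k)%Z -> root_sum z (mobius_rel a b c e k) = 0 -> a = 0.
Proof.
move=> pn np2 n14 k7.
have z0 := prim_root_neq0 prz.
wlog : k k7 / exists j, k = 7 * j + 1 \/ k = 7 * j + 2 \/ k = 7 * j + 3.
  move=> H s0; have [j|m] : (exists j, k = 7 * j + 1 \/ k = 7 * j + 2 \/ k = 7 * j + 3)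
    \/ (exists j, - k = 7 * j + 1 \/ - k = 7 * j + 2 \/ - k = 7 * j + 3).
    have [] : (k %% 7 <= 3)%Z \/ ((- k) %% 7 <= 3)%Z by lia.
      by left; exists (k %/ 7)%Z; lia.
    by right; exists ((- k) %/ 7)%Z; lia.
    exact: (H k).
  by apply: (H (- k)); rewrite ?root_sum_mobius_relN //; lia.
move=> [j Dk] s0.
have [y pry Hy] := residue_part_exact (isT : prime 7) pn np2 prz.
have y0 := prim_root_neq0 pry.
have E r r' : root_sum y (residue_part 7 r (mobius_rel a b c e k)) =
    root_sum y (residue_part 7 r' (mobius_rel a b c e k)).
  by apply: (@mulfI _ 7%:R); rewrite ?pnatr_eq0 // !Hy.
apply/eqP; apply: contraNT n14 => a0.
suff : (n %/ 7 %| 2)%N by move=> d; rewrite -(divnK pn) (@dvdn_mul _ 7 2 7).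
case: Dk => [Dk|[] Dk].
- have D2 : residue_part 7 2 (mobius_rel a b c e k) = [:: (a, k + 1)] by classify Dk.
  have D3 : residue_part 7 3 (mobius_rel a b c e k) = [::] by classify Dk.
  by have := E 2 3; rewrite D2 D3 root_sum_nil => /(root_sum1 y0)/eqP; rewrite (negPf a0).
- have D3 : residue_part 7 3 (mobius_rel a b c e k) = [:: (a, k + 1)] by classify Dk.
  have D0 : residue_part 7 0 (mobius_rel a b c e k) = [:: (e, 0)] by classify Dk.
  have D2 : residue_part 7 2 (mobius_rel a b c e k) = [:: (b, k)] by classify Dk.
  have e1 := E 3 0; have e2 := E 2 0.
  rewrite D3 D0 D2 !root_sumE in e1 e2.
  have d1 : ((n %/ 7)%N %| 2 * (k + 1))%Z.
    by apply: (rational_power_dvd (c' := - e) pry a0); rewrite rmorphN /= e1 subrr.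
  have b0 : b != 0.
    apply: contraNneq a0 => b0; move: e1; rewrite -e2 b0 rmorph0 mul0r => /eqP.
    by rewrite mulf_eq0 fmorph_eq0 expfz_eq0 (negPf y0) andbF orbF.
  have d2 : ((n %/ 7)%N %| 2 * k)%Z.
    by apply: (rational_power_dvd (c' := - e) pry b0); rewrite rmorphN /= e2 subrr.
  have : ((n %/ 7)%N %| 2 * (k + 1) - 2 * k)%Z by rewrite rpredB.
  by have -> : 2 * (k + 1) - 2 * k = 2 by ring.
have D2 : residue_part 7 2 (mobius_rel a b c e k) = [:: (a, k - 1)] by classify Dk.
have D0 : residue_part 7 0 (mobius_rel a b c e k) = [:: (e, 0)] by classify Dk.
have D1 : residue_part 7 1 (mobius_rel a b c e k) = [:: (c, 1)] by classify Dk.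
have e1 := E 2 0; have e2 := E 1 0.
rewrite D2 D0 D1 !root_sumE in e1 e2.
have c0 : c != 0.
  apply: contraNneq a0 => b0; move: e1; rewrite -e2 b0 rmorph0 mul0r => /eqP.
  by rewrite mulf_eq0 fmorph_eq0 expfz_eq0 (negPf y0) andbF orbF.
have : ((n %/ 7)%N %| 2 * 1)%Z.
  by apply: (rational_power_dvd (c' := - e) pry c0); rewrite rmorphN /= e2 subrr.
by rewrite mulr1.
Qed.

(** Up to [k -> - k], the residue of [k] modulo 5 is 1 or 2.  For 1, the exponent
    [k + 1] is alone.  For 2, the classes 1 and 2 make [z^(k-2)] and [z^(2k+1)]
    rational, so that [z^10 = 1]. *)
Lemma mobius_rel_25 a b c e k : (25 %| n)%N ->
  ~~ (5%N %| k)%Z -> root_sum z (mobius_rel a b c e k) = 0 -> a = 0.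
Proof.
move=> pn k5.
have z0 := prim_root_neq0 prz.
wlog : k k5 / exists j, k = 5 * j + 1 \/ k = 5 * j + 2.
  move=> H s0; have [j|m] : (exists j, k = 5 * j + 1 \/ k = 5 * j + 2)
    \/ (exists j, - k = 5 * j + 1 \/ - k = 5 * j + 2).
    have [] : (k %% 5 <= 2)%Z \/ ((- k) %% 5 <= 2)%Z by lia.
      by left; exists (k %/ 5)%Z; lia.
    by right; exists ((- k) %/ 5)%Z; lia.
    exact: (H k).
  by apply: (H (- k)); rewrite ?root_sum_mobius_relN //; lia.
move=> [j Dk] s0.
have E r := @residue_part_sq n 5 z (mobius_rel a b c e k) r isT pn prz s0.
apply/eqP; apply: contraT => a0.
case: Dk => Dk.
- have D2 : residue_part 5 2 (mobius_rel a b c e k) = [:: (a, k + 1)] by classify Dk.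
  by have := E 2; rewrite D2 => /(root_sum1 z0)/eqP; rewrite (negPf a0).
have D2 : residue_part 5 2 (mobius_rel a b c e k) = [:: (a, - (k + 1)); (b, k)] by classify Dk.
have D1 : residue_part 5 1 (mobius_rel a b c e k) = [:: (a, k - 1); (c, 1)] by classify Dk.
have e1 := E 1; have e2 := E 2; rewrite D2 D1 !root_sumE in e1 e2.
have d1 : (n %| 2 * (k - 2))%Z.
  apply: (rational_power_dvd (c' := c) prz a0); apply: (mulIf z0).
  rewrite mul0r -[RHS]e1 expr1z mulrDl; congr (_ + _).
  by rewrite -mulrA -{2}(expr1z z) -expfzDr //; congr (_ * _ ^ _); ring.
have d2 : (n %| 2 * (- (2 * k + 1)))%Z.
  apply: (rational_power_dvd (c' := b) prz a0); apply: (@mulIf _ (z ^ k)); first exact: expfz_neq0.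
  rewrite mul0r -[RHS]e2 mulrDl; congr (_ + _).
  by rewrite -mulrA -expfzDr //; congr (_ * _ ^ _); ring.
(* The combination of the two exponents that eliminates k. *)
have : (n %| 10%:Z)%Z.
  have -> : 10%:Z = - (2 * (- (2 * k + 1)) + 2 * (2 * (k - 2))) by ring.
  by rewrite dvdzE abszN -dvdzE rpredD // dvdz_mull.
by rewrite dvdzE /= => /(dvdn_trans pn).
Qed.
End PrimitiveRoot.

Lemma dvdn_of_pfactors n m : (0 < n)%N -> (0 < m)%N ->
  (forall p e, prime p -> (p ^ e %| n)%N -> (p ^ e %| m)%N) -> (n %| m)%N.
Proof.
move=> n_gt0 m_gt0 H; apply/dvdn_partP => // p pn.
have pp : prime p by move: pn; rewrite mem_primes => /andP[].
by rewrite p_part; apply: H => //; rewrite pfactor_dvdnn.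
Qed.

Lemma prime_ge7 p : prime p -> [|| p == 2, p == 3, p == 5 | (6 < p)%N]%N.
Proof. by case: p => [|[|[|[|[|[|[|p]]]]]]]. Qed.

Lemma root_sum_shift z s i : z != 0 ->
  root_sum z [seq (x.1, x.2 + i) | x <- s] = z ^ i * root_sum z s.
Proof.
move=> z0; rewrite /root_sum big_map mulr_sumr; apply: eq_bigr => x _ /=.
by rewrite expfzDr //; ring.
Qed.

Lemma root_sum_pow z s (i : nat) :
  root_sum z [seq (x.1, i%:Z * x.2) | x <- s] = root_sum (z ^+ i) s.
Proof.
rewrite /root_sum big_map; apply: eq_bigr => x _ /=.
by rewrite -exprz_exp.
Qed.

Section PrimitiveRoot.
Variables (n : nat) (z : algC).
Hypothesis prz : n.-primitive_root z.

(** Without its quadratic term the relation has five exponents, and 0 is alone. *)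
Lemma mobius_rel_affine p b c e k : prime p -> (p %| n)%N -> ~~ (p %| k)%Z ->
  (p ^ 2 %| n)%N || (6 < p)%N -> root_sum z (mobius_rel 0 b c e k) = 0 -> e = 0.
Proof.
move=> pp pn pk h s0; have p0 : (p %| - k)%Z = false.
  by rewrite dvdzE abszN -dvdzE (negPf pk).
have p1 : (p %| 1)%Z = false by rewrite dvdz1 /=; case: eqP pp => // ->.
have s1 : root_sum z [:: (b, k); (b, - k); (c, 1); (c, - 1); (e, 0)] = 0.
  have d x t : root_sum z ((0, x) :: t) = root_sum z t by rewrite root_sum_cons rmorph0 mul0r add0r.
  by move: s0; rewrite /mobius_rel !d.
apply: (@lone_exponent_eq0 n p z [:: (b, k); (b, - k); (c, 1); (c, - 1); (e, 0)] 0 e 0) => //.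
  by case/orP: h => [->//|p6]; rewrite (leq_trans _ p6) ?orbT.
rewrite /residue_part /= !subr0 p0 (negPf pk) p1 dvdz0.
by rewrite dvdzE abszN -dvdzE p1.
Qed.

(** Up to [k -> - k] one has [k = 3 j + 1], and the classes 0 and 1 modulo 3 are
    relations between powers of [x = z^3], with exponents [j], [- j], 0 for the
    first and [- j - 1], [j], 0 for the second.  Let [p] be a prime factor of
    [n/3], either greater than 3 or equal to 3 with 9 dividing [n/3].  If [p] does
    not divide [j], then [j] is alone in the first relation, and if it does, then
    [- j - 1] is alone in the second.  Without such a [p], and as 4 does not divide
    [n], the order [n/3] of [x] divides 6. *)
Lemma mobius_rel_9 a b c e k : (9 %| n)%N -> ~~ (n %| 18)%N -> ~~ (4 %| n)%N ->
  ~~ (3%N %| k)%Z -> root_sum z (mobius_rel a b c e k) = 0 -> a = 0.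
Proof.
move=> n9 n18 n4 k3.
have z0 := prim_root_neq0 prz; have n_gt0 := prim_order_gt0 prz.
wlog [j Dk] : k k3 / exists j, k = 3 * j + 1.
  move=> H s0; have [j|m] : (exists j, k = 3 * j + 1) \/ (exists j, - k = 3 * j + 1).
    have [] : (k %% 3 <= 1)%Z \/ ((- k) %% 3 <= 1)%Z by lia.
      by left; exists (k %/ 3)%Z; lia.
    by right; exists ((- k) %/ 3)%Z; lia.
    exact: (H k).
  by apply: (H (- k)); rewrite ?root_sum_mobius_relN //; lia.
move=> s0.
have E r := @residue_part_sq n 3 z (mobius_rel a b c e k) r isT n9 prz s0.
have E0 : root_sum (z ^+ 3) [:: (a, j); (a, - j); (e, 0)] = 0.
  rewrite -root_sum_pow /=; apply: (etrans _ (E 0)); congr root_sum.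
  have -> : residue_part 3 0 (mobius_rel a b c e k) =
      [:: (a, k - 1); (a, - (k - 1)); (e, 0)] by classify Dk.
  by congr [:: (_, _); (_, _); (_, _)]; lia.
have E1 : root_sum (z ^+ 3) [:: (a, - j - 1); (b, j); (c, 0)] = 0.
  rewrite -root_sum_pow /=; apply: (mulfI (expfz_neq0 1 z0)).
  rewrite -root_sum_shift // [RHS]mulr0 /=; apply: (etrans _ (E 1)); congr root_sum.
  have -> : residue_part 3 1 (mobius_rel a b c e k) =
      [:: (a, - (k + 1)); (b, k); (c, 1)] by classify Dk.
  by congr [:: (_, _); (_, _); (_, _)]; lia.
have n3 : (3 %| n)%N by apply: dvdn_trans n9.
have prx : (n %/ 3).-primitive_root (z ^+ 3).
  by have := exp_prim_root prz 3; rewrite (gcdn_idPl n3).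
apply/eqP; apply: contraNT n18 => a0.
suff: (n %/ 3 %| 6)%N by move=> d; rewrite -(divnK n3) (@dvdn_mul _ 3 6 3).
have bad p : prime p -> (2 < p)%N -> (p %| n %/ 3)%N ->
    (p ^ 2 %| n %/ 3)%N || (3 < p)%N -> false.
  move=> pp p2 pn h; case/negP: a0.
  have D2 x : (p %| 2 * x)%Z = (p %| x)%Z.
    by rewrite Gauss_dvdzr // coprimezE /= prime_coprime // gtnNdvd.
  have N x : (p %| - x)%Z = (p %| x)%Z by rewrite !dvdzE abszN.
  have p1 : (p %| 1)%Z = false by rewrite dvdz1 /=; case: eqP pp => // ->.
  have [pj|pj] := boolP (p %| j)%Z; last first.
    apply/eqP; apply: (lone_exponent_eq0 (r := j) (s := [:: (a, j); (a, - j); (e, 0)])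
      pp pn prx h E0).
    rewrite /residue_part /= subrr dvdz0 sub0r N (negPf pj).
    have -> : - j - j = - (2 * j) by ring.
    by rewrite N D2 (negPf pj).
  apply/eqP; apply: (lone_exponent_eq0 (r := - j - 1) (s := [:: (a, - j - 1); (b, j); (c, 0)])
    pp pn prx h E1).
  rewrite /residue_part /= subrr dvdz0 sub0r N.
  have -> : j - (- j - 1) = 2 * j + 1 by ring.
  have -> : - j - 1 = - (j + 1) by ring.
  by rewrite N !(rpredDl) ?p1 ?D2 //= dvdz_mull.
have m_gt0 := prim_order_gt0 prx.
apply: dvdn_of_pfactors => // p f pp pf.
case: f pf => [|f pf]; first by rewrite expn0 dvd1n.
have pn : (p %| n %/ 3)%N by apply: dvdn_trans pf; rewrite expnS dvdn_mulr.
have sq : (1 < f.+1)%N -> (p ^ 2 %| n %/ 3)%N.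
  by move=> f1; apply: dvdn_trans pf; rewrite dvdn_exp2l.
have := prime_ge7 pp => /or4P[/eqP e2|/eqP e3|/eqP e5|p6].
- case: f sq pf => [|f sq _]; first by rewrite e2.
  case/negP: n4; rewrite -(divnK n3) dvdn_mulr //.
  by have := sq isT; rewrite e2.
- case: f sq pf => [|f sq _]; first by rewrite e3.
  by have := bad p pp; rewrite sq // e3 => /(_ isT); rewrite -{1}e3 pn => /(_ isT isT).
- by have := bad p pp; rewrite e5 orbT => /(_ isT); rewrite -{1}e5 pn => /(_ isT isT).
- have p2 : (2 < p)%N by apply: leq_trans p6.
  by have := bad p pp p2 pn; rewrite (leq_trans _ p6) ?orbT // => /(_ isT).
Qed.

End PrimitiveRoot.

(** The terms of [a theta_1 theta_k + e].  If [k] is odd, they are the terms of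
    [mobius_rel] with an even exponent. *)
Definition product_rel (a e : rat) (k : int) : seq (rat * int) :=
  [:: (a, k + 1); (a, - (k + 1)); (a, k - 1); (a, - (k - 1)); (e, 0)].

Section PrimitiveRoot.
Variables (n : nat) (z : algC).
Hypothesis prz : n.-primitive_root z.

(** As [p] does not divide both [k + 1] and [k - 1], one of them is alone. *)
Lemma product_rel_odd p a e k : prime p -> (p %| n)%N -> (2 < p)%N ->
  (p ^ 2 %| n)%N || (6 < p)%N -> ~~ (p %| k)%Z ->
  root_sum z (product_rel a e k) = 0 -> a = 0.
Proof.
move=> pp pn p2 h pk s0.
have D2 x : (p %| 2 * x)%Z = (p %| x)%Z.
  by rewrite Gauss_dvdzr // coprimezE /= prime_coprime // gtnNdvd.
have N x : (p %| - x)%Z = (p %| x)%Z by rewrite !dvdzE abszN.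
have N2 : (p %| 2)%Z = false by rewrite dvdzE gtnNdvd.
have {}h : (p ^ 2 %| n)%N || (size (product_rel a e k) < p)%N.
  by case/orP: h => [->//|p6]; rewrite (leq_trans _ p6) ?orbT.
have [pk1|pk1] := boolP (p %| k + 1)%Z; last first.
  apply: (lone_exponent_eq0 (r := k + 1) pp pn prz h s0).
  rewrite /residue_part /= subrr dvdz0 sub0r N (negPf pk1).
  have -> : - (k + 1) - (k + 1) = - (2 * (k + 1)) by ring.
  have -> : k - 1 - (k + 1) = - 2 by ring.
  have -> : - (k - 1) - (k + 1) = - (2 * k) by ring.
  by rewrite !N !D2 N2 (negPf pk) (negPf pk1).
have pk2 : (p %| k - 1)%Z = false.
  apply/negP => d; have : (p %| (k + 1) - (k - 1))%Z by rewrite rpredB.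
  by have -> : (k + 1) - (k - 1) = 2 by [ring]; rewrite N2.
apply: (lone_exponent_eq0 (r := k - 1) pp pn prz h s0).
rewrite /residue_part /= subrr dvdz0 sub0r N pk2.
have -> : - (k + 1) - (k - 1) = - (2 * k) by ring.
have -> : k + 1 - (k - 1) = 2 by ring.
have -> : - (k - 1) - (k - 1) = - (2 * (k - 1)) by ring.
by rewrite !N !D2 N2 (negPf pk) pk2.
Qed.

(** If [k] is 1 or -1 modulo 5, one of the exponents [k + 1] and [k - 1] is alone
    and another class is empty.  Otherwise both are alone, so that
    [y^(k+1) = y^(k-1)] and [y^2 = 1], which contradicts that the order [n/5] of
    [y] is a multiple of 4. *)
Lemma product_rel_5 a e k : (5 %| n)%N -> ~~ (25 %| n)%N -> (4 %| n)%N ->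
  ~~ (5%N %| k)%Z -> root_sum z (product_rel a e k) = 0 -> a = 0.
Proof.
move=> n5 n25 n4 k5 s0.
have [y pry Hy] := residue_part_exact (isT : prime 5) n5 n25 prz.
have y0 := prim_root_neq0 pry.
have E r r' : root_sum y (residue_part 5 r (product_rel a e k)) =
    root_sum y (residue_part 5 r' (product_rel a e k)).
  by apply: (@mulfI _ 5%:R); rewrite ?pnatr_eq0 // !Hy.
apply/eqP; apply: contraT => a0.
have two : (n %/ 5 %| 2)%N -> false.
  have c : (4 %| n %/ 5)%N by rewrite -(@Gauss_dvdl 4 _ 5) // divnK.
  by move=> d; have := dvdn_trans c d.
have noteq (i j : int) : i - j = 2 \/ i - j = - 2 ->
    root_sum y [:: (a, i)] = root_sum y [:: (a, j)] -> false.
  move=> Dij; rewrite !root_sumE => /(mulfI (_ : ratr a != 0)).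
  rewrite fmorph_eq0 => /(_ a0) eij.
  have : (n %/ 5 %| `|i - j|)%N.
    rewrite -[(_ %| _)%N]/((n %/ 5)%N %| i - j)%Z -(prim_exprz_eq1 _ pry).
    by rewrite expfzDr // eij -expfzDr // subrr.
  by case: Dij => ->.
have [j [Dk|[Dk|[Dk|Dk]]]] : exists j, k = 5 * j + 1 \/ k = 5 * j + 2 \/
    k = 5 * j + 3 \/ k = 5 * j + 4 by exists (k %/ 5)%Z; lia.
- have D2 : residue_part 5 2 (product_rel a e k) = [:: (a, k + 1)] by classify Dk.
  have D1 : residue_part 5 1 (product_rel a e k) = [::] by classify Dk.
  by have := E 2 1; rewrite D2 D1 root_sum_nil => /(root_sum1 y0)/eqP; rewrite (negPf a0).
- have D2 : residue_part 5 3 (product_rel a e k) = [:: (a, k + 1)] by classify Dk.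
  have D1 : residue_part 5 1 (product_rel a e k) = [:: (a, k - 1)] by classify Dk.
  by have := E 3 1; rewrite D2 D1; apply: noteq; left; ring.
- have D2 : residue_part 5 4 (product_rel a e k) = [:: (a, k + 1)] by classify Dk.
  have D1 : residue_part 5 2 (product_rel a e k) = [:: (a, k - 1)] by classify Dk.
  by have := E 4 2; rewrite D2 D1; apply: noteq; left; ring.
- have D2 : residue_part 5 3 (product_rel a e k) = [:: (a, k - 1)] by classify Dk.
  have D1 : residue_part 5 1 (product_rel a e k) = [::] by classify Dk.
  by have := E 3 1; rewrite D2 D1 root_sum_nil => /(root_sum1 y0)/eqP; rewrite (negPf a0).
Qed.

(** The root z^2 has order [n/2], and exactly one of [(k+1)/2] and [(k-1)/2], say
    [j], is odd.  The odd exponents of z^2 give [z^(2j) + z^(-2j) = 0], so that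
    [z^(8j) = 1], but [8 j] is not a multiple of 16. *)
Lemma product_rel_16 a e k : (16 %| n)%N -> ~~ (2%N %| k)%Z ->
  root_sum z (product_rel a e k) = 0 -> a = 0.
Proof.
move=> n16 k2 s0.
have n2 : (2 %| n)%N by apply: dvdn_trans n16.
have pry : (n %/ 2).-primitive_root (z ^+ 2).
  by have := exp_prim_root prz 2; rewrite (gcdn_idPl n2).
have [i Dk] : exists i, k = 2 * i + 1 by exists (k %/ 2)%Z; lia.
have y0 := prim_root_neq0 pry.
have E0 : root_sum (z ^+ 2) [:: (a, i + 1); (a, - (i + 1)); (a, i); (a, - i); (e, 0)] = 0.
  rewrite -root_sum_pow /= -[RHS]s0; congr root_sum.
  by congr [:: (_, _); (_, _); (_, _); (_, _); (_, _)]; lia.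
have four : (2 ^ 2 %| n %/ 2)%N.
  by rewrite -(@dvdn_pmul2r 2) // divnK //; apply: dvdn_trans n16.
have E r := @residue_part_sq _ 2 _ _ r isT four pry E0.
apply/eqP; apply: contraT => a0.
have odd_j j : ~~ (2%N %| j)%Z -> root_sum (z ^+ 2) [:: (a, j); (a, - j)] = 0 -> false.
  move=> j2; rewrite !root_sumE -mulrDr => /eqP.
  rewrite mulf_eq0 fmorph_eq0 (negPf a0) /= addr_eq0 => /eqP e1.
  have : (z ^+ 2) ^ (4 * j) = 1.
    have -> : 4 * j = (j * 2%N%:Z) * 2%N%:Z by lia.
    rewrite -2!exprz_exp -2!exprnP.
    have -> : ((z ^+ 2) ^ j) ^+ 2 = - 1.
      by rewrite expr2 {2}e1 mulrN -expfzDr // subrr.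
    by rewrite sqrrN expr1n.
  move/eqP; rewrite (prim_exprz_eq1 _ pry) => d.
  have : (8%N %| 4 * j)%Z.
    apply: dvdz_trans d; rewrite dvdzE /=.
    by rewrite -(@dvdn_pmul2r 2) // divnK.
  by move: j2; clear; lia.
have [i2|i2] := boolP (2%N %| i)%Z.
  apply: (@odd_j (i + 1)); first by lia.
  by rewrite -[RHS](E 1); congr root_sum; symmetry; classify i2.
apply: (@odd_j i) => //.
by rewrite -[RHS](E 1); congr root_sum; symmetry; classify i2.
Qed.

Lemma product_rel_dvd24 a e k : (4 %| n)%N -> ~~ (n %| 24)%N ->
  (forall p, prime p -> (p %| n)%N -> ~~ (p %| k)%Z) ->
  root_sum z (product_rel a e k) = 0 -> a = 0.
Proof.
move=> n4 n24 pk s0; apply/eqP; apply: contraNT n24 => a0.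
have n_gt0 := prim_order_gt0 prz.
have A0 : a <> 0 by apply/eqP.
apply: dvdn_of_pfactors => // p f pp pf.
case: f pf => [|f pf]; first by rewrite expn0 dvd1n.
have pn : (p %| n)%N by apply: dvdn_trans pf; rewrite expnS dvdn_mulr.
have sq : (1 < f.+1)%N -> (p ^ 2 %| n)%N.
  by move=> f1; apply: dvdn_trans pf; rewrite dvdn_exp2l.
have kp := pk p pp pn.
have := prime_ge7 pp => /or4P[/eqP e2|/eqP e3|/eqP e5|p6].
- have [f3|f3] := leqP f.+1 3.
    by rewrite e2 (@dvdn_trans (2 ^ 3)) // dvdn_exp2l.
  have n16 : (16 %| n)%N.
    by apply: dvdn_trans pf; rewrite e2 (@dvdn_exp2l 2 4).
  by exfalso; have := A0 (product_rel_16 n16 _ s0); rewrite -e2 => /(_ kp).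
- case: f sq pf => [|f sq _]; first by rewrite e3.
  exfalso; have := A0 (product_rel_odd pp pn _ _ kp s0).
  by rewrite sq // e3 => /(_ isT isT).
- exfalso; have [p2|p2] := boolP (p ^ 2 %| n)%N.
    by have := A0 (product_rel_odd pp pn _ _ kp s0); rewrite p2 e5 => /(_ isT isT).
  by move: pn kp p2; rewrite e5 => pn kp p2; apply: A0; apply: product_rel_5 pn p2 n4 kp s0.
- exfalso; have p2 : (2 < p)%N by apply: leq_trans p6.
  by have := A0 (product_rel_odd pp pn p2 _ kp s0); rewrite p6 orbT => /(_ isT).
Qed.

(** If 4 divides [n], then [k] is odd and the terms with an even exponent form a
    relation [a theta_1 theta_k + e = 0], which is trivial unless [n] divides 24.
    Otherwise [n] is a multiple of 25, of 9 or of a prime [p >= 7], or else it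
    divides 30. *)
Lemma mobius_rel_trivial a b c e k :
  n \notin [:: 1; 2; 3; 4; 5; 6; 8; 10; 12]%N ->
  n \notin [:: 7; 9; 14; 15; 18; 24; 30]%N ->
  (forall p, prime p -> (p %| n)%N -> ~~ (p %| k)%Z) ->
  root_sum z (mobius_rel a b c e k) = 0 -> a = 0 /\ e = 0.
Proof.
move=> nl1 nl2 pk s0; have n_gt0 := prim_order_gt0 prz.
have nd m : all (fun d => (d \in [:: 1; 2; 3; 4; 5; 6; 8; 10; 12]%N) ||
   (d \in [:: 7; 9; 14; 15; 18; 24; 30]%N)) (divisors m) -> (0 < m)%N -> ~~ (n %| m)%N.
  move=> /allP al m0; apply/negP => d.
  by have := al n; rewrite -dvdn_divisors // d (negPf nl1) (negPf nl2) => /(_ isT).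
have n14 := nd 14 isT isT; have n18 := nd 18 isT isT.
have n24 := nd 24 isT isT; have n30 := nd 30 isT isT.
have [n4|n4] := boolP (4 %| n)%N.
  have n2 : (2 %| n)%N by apply: dvdn_trans n4.
  have k2 : ~~ (2%N %| k)%Z by apply: pk.
  suff a0 : a = 0.
    split=> //; apply: (mobius_rel_affine prz (p := 2) (k := k) (b := b) (c := c)) => //.
      by rewrite n4.
    by rewrite -a0.
  apply: (product_rel_dvd24 n4 n24 pk (e := e)).
  rewrite -(@residue_part_sq n 2 z _ 0 isT n4 prz s0); congr root_sum.
  by rewrite /product_rel; symmetry; classify k2.
have [p [pp pn h a0]] : exists p, [/\ prime p, (p %| n)%N,
    (p ^ 2 %| n)%N || (6 < p)%N & a = 0]; last first.
  split=> //; apply: (mobius_rel_affine prz pp pn (pk p pp pn) h (b := b) (c := c)).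
  by rewrite -a0.
have [n25|n25] := boolP (25 %| n)%N.
  exists 5%N; split=> //; first by apply: dvdn_trans n25.
    by rewrite n25.
  apply: (mobius_rel_25 prz n25 _ s0); apply: pk => //.
  by apply: dvdn_trans n25.
have [n9|n9] := boolP (9 %| n)%N.
  exists 3%N; split=> //; first by apply: dvdn_trans n9.
    by rewrite n9.
  apply: (mobius_rel_9 prz n9 n18 n4 _ s0); apply: pk => //.
  by apply: dvdn_trans n9.
have [/existsP[[p lt_p] /= /and3P[pp pn p6]]|] :=
    boolP [exists p : 'I_n.+1, [&& prime p, (p %| n)%N & (6 < p)%N]].
  exists p; split=> //; first by rewrite p6 orbT.
  have [h|/norP[p2 p9]] := boolP ((p ^ 2 %| n)%N || (9 < p)%N).
    exact: (mobius_rel_large prz pp pn p6 h (pk p pp pn) s0).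
  have e7 : p = 7%N by case: p pp {lt_p pn p2} p6 p9 => [|[|[|[|[|[|[|[|[|[|p]]]]]]]]]].
  move: pn p2; rewrite e7 => pn p2.
  exact: (mobius_rel_7 prz pn p2 n14 (pk 7%N isT pn) s0).
move=> /existsPn np; case/negP: n30.
apply: dvdn_of_pfactors => // p f pp pf.
case: f pf => [|f pf]; first by rewrite expn0 dvd1n.
have pn : (p %| n)%N by apply: dvdn_trans pf; rewrite expnS dvdn_mulr.
have sq : (1 < f.+1)%N -> (p ^ 2 %| n)%N.
  by move=> f1; apply: dvdn_trans pf; rewrite dvdn_exp2l.
have lt_p : (p < n.+1)%N by rewrite ltnS dvdn_leq.
have := np (Ordinal lt_p); rewrite /= pp pn /= => p6.
have := prime_ge7 pp => /or4P[/eqP e2|/eqP e3|/eqP e5|]; last by rewrite (negPf p6).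
- by move: sq; rewrite e2; case: (f) => [|f'] // sq; case/negP: n4; apply: sq.
- by move: sq; rewrite e3; case: (f) => [|f'] // sq; case/negP: n9; apply: sq.
- by move: sq; rewrite e5; case: (f) => [|f'] // sq; case/negP: n25; apply: sq.
Qed.

End PrimitiveRoot.

(** * Subgroups of GL_2 generated by matrices *)

Lemma mx2_eta (M : 'M[rat]_2) : M = mx2 (M 0 0) (M 0 1) (M 1 0) (M 1 1).
Proof.
apply/matrixP => i j; rewrite !mxE.
by case: i j => [[|[|//]] ?] [[|[|//]] ?] /=; congr (M _ _); apply: val_inj.
Qed.

Lemma mx2E a b c d : ((mx2 a b c d 0 0 = a) * (mx2 a b c d 0 1 = b) *
  (mx2 a b c d 1 0 = c) * (mx2 a b c d 1 1 = d))%type.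
Proof. by rewrite !mxE. Qed.

Lemma mx2M a b c d a' b' c' d' : mx2 a b c d *m mx2 a' b' c' d' =
  mx2 (a * a' + b * c') (a * b' + b * d') (c * a' + d * c') (c * b' + d * d').
Proof.
apply/matrixP => i j; rewrite !mxE !big_ord_recl big_ord0 addr0 !mxE /=.
by case: i j => [[|[|//]] ?] [[|[|//]] ?] /=.
Qed.

Lemma mx2_1 : 1%:M = mx2 1 0 0 1.
Proof.
by apply/matrixP => i j; rewrite !mxE; case: i j => [[|[|//]] ?] [[|[|//]] ?].
Qed.

Lemma mx2N a b c d : - mx2 a b c d = mx2 (- a) (- b) (- c) (- d).
Proof.
by apply/matrixP => i j; rewrite !mxE; case: i j => [[|[|//]] ?] [[|[|//]] ?].
Qed.

Lemma mx2Z l a b c d : l *: mx2 a b c d = mx2 (l * a) (l * b) (l * c) (l * d).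
Proof.
by apply/matrixP => i j; rewrite !mxE; case: i j => [[|[|//]] ?] [[|[|//]] ?].
Qed.

Lemma mx2_unit (M : 'M[rat]_2) :
  (M \in unitmx) = (M 0 0 * M 1 1 - M 0 1 * M 1 0 != 0).
Proof.
rewrite unitmxE unitfE (expand_det_row M 0) !big_ord_recl big_ord0 /cofactor.
rewrite !det_mx11 !mxE /= expr0 expr1 mul1r addr0 mulN1r mulrN.
by congr (M _ _ * M _ _ - M _ _ * M _ _ != 0); apply: val_inj.
Qed.

Lemma mx2_unitN (M : 'M[rat]_2) : (- M \in unitmx) = (M \in unitmx).
Proof. by rewrite !mx2_unit !mxE !mulrNN. Qed.

Lemma subgroup_unit : subgroup_GL2 [set M | M \in unitmx].
Proof.
split=> //=; first exact: unitmx1.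
  by move=> M N /= HM HN; rewrite unitmx_mul HM.
by move=> M /=; rewrite unitmx_inv.
Qed.

Section Generated.
Variable S : set 'M[rat]_2.
Hypothesis unitS : S `<=` [set M | M \in unitmx].

Lemma generated_in M : S M -> generated S M.
Proof. by move=> SM K [_ SK]; apply: SK. Qed.

Lemma generated_sub K : subgroup_GL2 K -> S `<=` K -> generated S `<=` K.
Proof. by move=> gK SK M; apply. Qed.

Lemma generated_group : subgroup_GL2 (generated S).
Proof.
split.
- exact: generated_sub subgroup_unit unitS.
- by move=> K [[]].
- by move=> M N HM HN K KS; case: (KS) => -[_ _ KM _] _; apply: KM; [apply: HM|apply: HN].
- by move=> M HM K KS; case: (KS) => -[_ _ _ KV] _; apply: KV; apply: HM.
Qed.

End Generated.

Lemma generated_eq S T : S `<=` [set M | M \in unitmx] -> T `<=` [set M | M \in unitmx] ->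
  S `<=` generated T -> T `<=` generated S -> generated S = generated T.
Proof.
move=> uS uT ST TS; apply/seteqP; split; apply: generated_sub => //; exact: generated_group.
Qed.

Definition conj_mx (P M : 'M[rat]_2) := invmx P *m M *m P.

Section Conjugation.
Variable P : 'M[rat]_2.
Hypothesis unitP : P \in unitmx.

Lemma conj_mxM M N : conj_mx P (M *m N) = conj_mx P M *m conj_mx P N.
Proof. by rewrite /conj_mx !mulmxA mulmxK. Qed.

Lemma conj_mx1 : conj_mx P 1%:M = 1%:M.
Proof. by rewrite /conj_mx mulmx1 mulVmx. Qed.

Lemma conj_mx_unit M : (conj_mx P M \in unitmx) = (M \in unitmx).
Proof. by rewrite /conj_mx !unitmx_mul unitmx_inv unitP andbT. Qed.

Lemma conj_mxV M : M \in unitmx -> conj_mx P (invmx M) = invmx (conj_mx P M).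
Proof.
move=> uM; have u : conj_mx P M \in unitmx by rewrite conj_mx_unit.
by rewrite -[LHS]mulmx1 -(mulmxV u) mulmxA -conj_mxM mulVmx // conj_mx1 mul1mx.
Qed.

Lemma conj_mx_eq M N : P *m N = M *m P -> conj_mx P M = N.
Proof. by move=> e; rewrite /conj_mx -mulmxA -e mulmxA mulVmx // mul1mx. Qed.

(** Reduces the conjugacy of two generated groups to that of their
    generators. *)
Lemma conj_mx_generated (S : set 'M[rat]_2) : S `<=` [set M | M \in unitmx] ->
  [set conj_mx P M | M in generated S] = generated [set conj_mx P M | M in S].
Proof.
move=> uS; have uT : [set conj_mx P M | M in S] `<=` [set M | M \in unitmx].
  by move=> _ [M SM <-] /=; rewrite conj_mx_unit; apply: uS.
have [gu g1 gM gV] := generated_group uS; have [hu h1 hM hV] := generated_group uT.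
apply/seteqP; split; last first.
  apply: generated_sub; last by move=> _ [M SM <-]; exists M => //; apply: generated_in.
  split.
  - by move=> _ [M SM <-] /=; rewrite conj_mx_unit; apply: gu.
  - by exists 1%:M => //; rewrite conj_mx1.
  - by move=> _ _ [M SM <-] [N SN <-]; exists (M *m N); [apply: gM|rewrite conj_mxM].
  - by move=> _ [M SM <-]; exists (invmx M); [apply: gV|rewrite conj_mxV //; apply: gu].
move=> _ [M SM <-].
suff : generated S `<=`
    [set M | M \in unitmx /\ generated [set conj_mx P M | M in S] (conj_mx P M)].
  by move=> /(_ M SM)[].
apply: generated_sub; last by move=> N SN; split; [apply: uS|apply: generated_in; exists N].
split.
- by move=> N [].
- by split; [exact: unitmx1|rewrite conj_mx1].
- by move=> A B [uA HA] [uB HB]; split; [rewrite unitmx_mul uA|rewrite conj_mxM; apply: hM].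
- by move=> A [uA HA]; split; [rewrite unitmx_inv|rewrite conj_mxV //; apply: hV].
Qed.

Lemma conj_mx_isomorphic H : isomorphic [set conj_mx P M | M in H] H.
Proof.
have cK M : P *m conj_mx P M *m invmx P = M.
  by rewrite /conj_mx !mulmxA mulmxK // mulmxV // mul1mx.
exists (fun M => P *m M *m invmx P); split; last first.
  move=> M N _ _; rewrite -[in RHS]mulmxA [invmx P *m _]mulmxA [invmx P *m (P *m _)]mulmxA.
  by rewrite mulVmx // mul1mx !mulmxA.
split.
- by move=> _ [M HM <-]; rewrite cK.
- by move=> _ _ /set_mem[M HM <-] /set_mem[N HN <-]; rewrite !cK => ->.
- by move=> M HM; exists (conj_mx P M); [exists M|rewrite cK].
Qed.

End Conjugation.

Lemma isomorphic_refl H : isomorphic H H.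
Proof.
exists id; split=> //; split=> // M HM; by exists M.
Qed.

(** * Binary forms and linear substitutions *)

Definition linform (a b : rat) : {mpoly rat[2]} := a *: var_x + b *: var_y.

Lemma form_act_homogenize p M : form_act (homogenize p) M =
  \sum_(i < size p) p`_i *: (linform (M 0 0) (M 0 1) ^+ i *
                             linform (M 1 0) (M 1 1) ^+ ((size p).-1 - i)).
Proof.
rewrite /form_act /homogenize raddf_sum; apply: eq_bigr => i _ /=.
by rewrite comp_mpolyZ rmorphM !rmorphXn /= !comp_mpolyXU.
Qed.

Lemma form_actM F M N : form_act (form_act F M) N = form_act F (M *m N).
Proof.
rewrite /form_act [F \mPo [tuple M 0 0 *: _ + _; _]]comp_mpolyE raddf_sum /=.
rewrite [RHS]comp_mpolyE; apply: eq_bigr => m _.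
rewrite comp_mpolyZ rmorph_prod /=; congr (_ *: _); apply: eq_bigr => i _.
rewrite rmorphXn /=; congr (_ ^+ _).
case: i => -[|[|//]] lt_i; rewrite !(tnth_nth 0) /=;
  rewrite comp_mpolyD !comp_mpolyZ !comp_mpolyXU /= !mxE !big_ord_recl !big_ord0 !addr0;
  rewrite !scalerDr !scalerA !scalerDl addrACA; congr (_ + _ + (_ + _)); congr (_ *: _);
  congr (M _ _ * N _ _); by apply: val_inj.
Qed.

Lemma form_act1 F : form_act F 1%:M = F.
Proof.
rewrite /form_act -[RHS]comp_mpoly_id; congr (_ \mPo _).
apply: eq_from_tnth => -[[|[|//]] lt_i]; rewrite !tnth_mktuple !(tnth_nth 0) /= !mxE /=.
  by rewrite scale1r scale0r addr0; congr 'X_(_); apply: val_inj.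
by rewrite scale1r scale0r add0r; congr 'X_(_); apply: val_inj.
Qed.

Lemma form_actN F M : form_act (- F) M = - form_act F M.
Proof. by rewrite /form_act comp_mpolyN. Qed.

(** The form of [p] at a point of any ring over the rationals: in [algC] it
    evaluates the form, in the ring of bivariate polynomials it substitutes linear
    forms into it.  Polynomial identities can thus be checked in an abstract
    ring. *)
Definition hform (R : comNzRingType) (c : rat -> R) (p : {poly rat}) (x y : R) : R :=
  \sum_(i < size p) c p`_i * (x ^+ i * y ^+ ((size p).-1 - i)).

Notation hformC := (hform (@ratr algC)).

Definition eval2 (x y : algC) : {mpoly rat[2]} -> algC :=
  mmap ratr (fun i : 'I_2 => if i == 0 then x else y).

Lemma eval2_linform x y a b : eval2 x y (linform a b) = ratr a * x + ratr b * y.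
Proof. by rewrite /eval2 mmapD !mmapZ !mmapX !mmap1U. Qed.

Lemma eval2_act x y p M : eval2 x y (form_act (homogenize p) M) =
  hformC p (ratr (M 0 0) * x + ratr (M 0 1) * y) (ratr (M 1 0) * x + ratr (M 1 1) * y).
Proof.
rewrite form_act_homogenize /eval2 raddf_sum; apply: eq_bigr => i _ /=.
by rewrite mmapZ rmorphM !rmorphXn /= -!/(eval2 _ _ _) !eval2_linform.
Qed.

Lemma eval2_homogenize x y p : eval2 x y (homogenize p) = hformC p x y.
Proof.
by rewrite -[homogenize p]form_act1 eval2_act !mxE /= rmorph1 rmorph0 !mul1r !mul0r addr0 add0r.
Qed.

Lemma hformC_x1 p x : hformC p x 1 = (map_poly ratr p).[x].
Proof.
rewrite (@horner_coef_wide _ (size p)) ?size_map_poly //.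
by apply: eq_bigr => i _; rewrite coef_map expr1n mulr1.
Qed.

Lemma hformC_scale p l x y : hformC p (l * x) (l * y) = l ^+ (size p).-1 * hformC p x y.
Proof.
rewrite /hform mulr_sumr; apply: eq_bigr => i _; rewrite !exprMn.
have le_i : (i <= (size p).-1)%N by have := ltn_ord i; lia.
rewrite -{3}(subnKC le_i) exprD; ring.
Qed.

Lemma hformC_x0 p x : hformC p x 0 = ratr (lead_coef p) * x ^+ (size p).-1.
Proof.
rewrite /hform lead_coefE; case: (size p) (nth_default 0 (leqnn (size p))) => [|n] z.
  by rewrite big_ord0 z rmorph0 mul0r.
rewrite big_ord_recr /= subnn mulr1 big1 ?add0r // => i _.
by rewrite -(subnSK (ltn_ord i)) expr0n !mulr0.
Qed.

Lemma hformC_y p x y : y != 0 ->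
  hformC p x y = y ^+ (size p).-1 * (map_poly ratr p).[x / y].
Proof.
move=> y0; rewrite -hformC_x1 -hformC_scale mulr1.
by rewrite mulrC divfK.
Qed.

Lemma form_act_hform p M : form_act (homogenize p) M =
  hform (@mpolyC 2 rat) p (linform (M 0 0) (M 0 1)) (linform (M 1 0) (M 1 1)).
Proof.
by rewrite form_act_homogenize; apply: eq_bigr => i _; rewrite mul_mpolyC.
Qed.

Lemma homogenize_hform p : homogenize p = hform (@mpolyC 2 rat) p var_x var_y.
Proof. by apply: eq_bigr => i _; rewrite mul_mpolyC. Qed.

(** * Automorphisms of a form without small rational relations *)

(** For a root [r] of [p], the powers of [r] up to [d - 1] are linearly
    independent over the rationals.  The bound on [d] excludes the numbers that a
    nontrivial Moebius transformation can fix. *)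
Definition min_form (p : {poly rat}) d := [/\ p \is monic, size p = d.+1, (2 < d)%N &
  forall (r : algC) q, root (map_poly ratr p) r -> root (map_poly ratr q) r ->
    q != 0 -> (size p <= size q)%N].

Section Automorphisms.
Variables (p : {poly rat}) (d : nat).
Hypothesis min_formp : min_form p d.
Let mon_p : p \is monic. Proof. by case: min_formp. Qed.
Let size_p : size p = d.+1. Proof. by case: min_formp. Qed.
Let d_gt2 : (2 < d)%N. Proof. by case: min_formp. Qed.
Let min_p (r : algC) q : root (map_poly ratr p) r -> root (map_poly ratr q) r ->
  q != 0 -> (size p <= size q)%N.
Proof. by case: min_formp => _ _ _; apply. Qed.
Let F := homogenize p.

Lemma poly_relation_eq0 (r : algC) (s : seq rat) : root (map_poly ratr p) r ->
  (size s <= d)%N -> (map_poly ratr (Poly s)).[r] = 0 -> forall i, s`_i = 0.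
Proof.
move=> rp ss s0 i; rewrite -coef_Poly; suff -> : Poly s = 0 by rewrite coef0.
apply/eqP; apply: contraT => /(min_p rp) h.
have := h (introT eqP s0); rewrite size_p ltnNge.
by rewrite (leq_trans (size_Poly s)).
Qed.

Lemma cubic_relation_eq0 (r : algC) a b c e : root (map_poly ratr p) r -> (3 < d)%N ->
  ratr a + ratr b * r + ratr c * r ^+ 2 + ratr e * r ^+ 3 = 0 ->
  [/\ a = 0, b = 0, c = 0 & e = 0].
Proof.
move=> rp d3 e0; have H := @poly_relation_eq0 r [:: a; b; c; e] rp d3.
have {}H : forall i, [:: a; b; c; e]`_i = 0.
  apply: H; rewrite (@horner_coef_wide _ 4) ?size_map_poly ?size_Poly //.
  rewrite !big_ord_recl big_ord0 !coef_map !coef_Poly /= expr0 mulr1 addr0.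
  by rewrite !addrA.
by have := (H 0%N, H 1%N, H 2%N, H 3%N) => -[[[]]].
Qed.

Lemma quadratic_relation_eq0 (r : algC) a b c : root (map_poly ratr p) r ->
  ratr a + ratr b * r + ratr c * r ^+ 2 = 0 -> [/\ a = 0, b = 0 & c = 0].
Proof.
move=> rp e0; have H := @poly_relation_eq0 r [:: a; b; c] rp d_gt2.
have {}H : forall i, [:: a; b; c]`_i = 0.
  apply: H; rewrite (@horner_coef_wide _ 3) ?size_map_poly ?size_Poly //.
  rewrite !big_ord_recl big_ord0 !coef_map !coef_Poly /= expr0 mulr1 addr0.
  by rewrite !addrA.
by have := (H 0%N, H 1%N, H 2%N) => -[[]].
Qed.

(** A nontrivial rational zero of the form would be a rational root of [p]. *)
Lemma hformC_rat_eq0 (a b : rat) : hformC p (ratr a) (ratr b) = 0 -> a = 0 /\ b = 0.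
Proof.
have [->|b0] := eqVneq b 0.
  rewrite rmorph0 hformC_x0 (monicP mon_p) rmorph1 mul1r size_p /= => /eqP.
  by rewrite expf_eq0 fmorph_eq0 => /andP[_ /eqP].
rewrite hformC_y ?fmorph_eq0 // => /eqP; rewrite mulf_eq0 expf_eq0 fmorph_eq0 (negPf b0).
rewrite andbF /= -fmorph_div => rt.
have : root (map_poly ratr ('X - (a / b)%:P)) (ratr (a / b) : algC).
  by rewrite rmorphB /= map_polyX map_polyC /= root_XsubC.
move=> /(min_p rt); rewrite polyXsubC_eq0 size_XsubC size_p => /(_ isT).
by rewrite ltnS leqNgt (ltn_trans _ d_gt2).
Qed.

Lemma Aut_AutAbs : Aut F `<=` AutAbs F.
Proof. by move=> M; left. Qed.

Lemma AutAbs_hformC M : AutAbs F M -> exists2 eps : algC, eps = 1 \/ eps = -1 &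
  forall x y, hformC p (ratr (M 0 0) * x + ratr (M 0 1) * y)
                    (ratr (M 1 0) * x + ratr (M 1 1) * y) = eps * hformC p x y.
Proof.
case=> e; [exists 1; first by left|exists (-1); first by right];
  by move=> x y; rewrite -eval2_act e ?/eval2 ?mmapN -/(eval2 _ _ _)
    eval2_homogenize ?mul1r ?mulN1r.
Qed.

(** A vector in the kernel of [M] is a rational zero of the form.  If the
    determinant vanishes, the columns of the adjugate of [M] are such vectors. *)
Lemma AutAbs_unit M : AutAbs F M -> M \in unitmx.
Proof.
case/AutAbs_hformC => eps Deps Hev; rewrite mx2_unit; apply/negP => /eqP det0.
have eps0 : eps != 0 by case: Deps => ->; rewrite ?oppr_eq0 oner_eq0.
have ker (x y : rat) : M 0 0 * x + M 0 1 * y = 0 -> M 1 0 * x + M 1 1 * y = 0 ->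
    x = 0 /\ y = 0.
  move=> e1 e2; apply: hformC_rat_eq0; apply: (mulfI eps0).
  by rewrite -Hev -!rmorphM -!rmorphD /= e1 e2 mulr0 rmorph0 hformC_x0 size_p
    expr0n gtn_eqF ?mulr0 // (ltn_trans _ d_gt2).
have [m11 m10] : M 1 1 = 0 /\ - M 1 0 = 0 by apply: ker; [rewrite -[RHS]det0|]; ring.
have [m01 m00] : - M 0 1 = 0 /\ M 0 0 = 0 by apply: ker; [|rewrite -[RHS]det0]; ring.
have m10' : M 1 0 = 0 by rewrite -[M 1 0]opprK m10 oppr0.
have m01' : M 0 1 = 0 by rewrite -[M 0 1]opprK m01 oppr0.
have [] := ker 1 0; rewrite ?m11 ?m10' ?m01' ?m00 ?mul0r ?addr0 //.
Qed.

Lemma form_act_inv G H M : M \in unitmx -> form_act G M = H ->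
  G = form_act H (invmx M).
Proof. by move=> uM <-; rewrite form_actM mulmxV // form_act1. Qed.

Lemma AutAbs_group : subgroup_GL2 (AutAbs F).
Proof.
split; first exact: AutAbs_unit.
- by left; apply: form_act1.
- move=> M N [HM|HM] [HN|HN]; rewrite /AutAbs /= -form_actM HM ?form_actN HN;
    rewrite ?opprK; by [left|right].
- move=> M HM; have uM := AutAbs_unit HM; case: HM => /(form_act_inv uM).
    by left.
  by rewrite form_actN => e; right; rewrite [in RHS]e opprK.
Qed.

Lemma Aut_group : subgroup_GL2 (Aut F).
Proof.
split; first by move=> M /Aut_AutAbs/AutAbs_unit.
- exact: form_act1.
- by move=> M N HM HN; rewrite /Aut /= -form_actM HM.
- by move=> M HM; have /Aut_AutAbs/AutAbs_unit uM := HM; rewrite /Aut /= -(form_act_inv uM HM).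
Qed.

Lemma form_neq_opp : F <> - F.
Proof.
move=> /(congr1 (eval2 1 0)); rewrite /eval2 mmapN -/(eval2 _ _ _) eval2_homogenize hformC_x0.
rewrite (monicP mon_p) rmorph1 expr1n mul1r => /eqP; rewrite -addr_eq0.
by rewrite -[1 + 1]/(2%:R) pnatr_eq0.
Qed.

Lemma form_act_diag s v : form_act F (mx2 s 0 0 v) =
  \sum_(i < size p) (p`_i * (s ^+ i * v ^+ (d - i))) *: (var_x ^+ i * var_y ^+ (d - i)).
Proof.
rewrite form_act_homogenize !mx2E size_p /=; apply: eq_bigr => i _.
by rewrite /linform !scale0r addr0 add0r !exprZn -scalerAl -scalerAr !scalerA mulrA.
Qed.

Lemma form_act_opp1 : form_act F (- 1%:M) = (-1) ^+ d *: F.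
Proof.
rewrite mx2_1 mx2N oppr0 form_act_diag /F /homogenize scaler_sumr size_p /=.
apply: eq_bigr => i _; rewrite scalerA -exprD subnKC; last by rewrite -ltnS.
by rewrite mulrC.
Qed.

Lemma form_act_oppM M : form_act F (- M) = (-1) ^+ d *: form_act F M.
Proof.
have -> : - M = (- 1%:M) *m M by rewrite mulNmx mul1mx.
by rewrite -form_actM form_act_opp1 /form_act comp_mpolyZ.
Qed.

Lemma AutAbs_opp1 : AutAbs F (- 1%:M).
Proof.
rewrite /AutAbs /= form_act_opp1 -signr_odd; case: odd; [right|left].
  by rewrite expr1 scaleN1r.
by rewrite expr0 scale1r.
Qed.

Lemma Aut_even_oppM M : ~~ odd d -> Aut F M -> Aut F (- M).
Proof.
by move=> d2 HM; rewrite /Aut /= form_act_oppM -signr_odd (negPf d2) scale1r HM.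
Qed.

Lemma Aut_odd_oppM M : odd d -> Aut F M -> ~ Aut F (- M).
Proof.
move=> d2 HM; rewrite /Aut /= form_act_oppM -signr_odd d2 expr1 scaleN1r HM.
by move/esym; apply: form_neq_opp.
Qed.

(** [M] maps [x] to [y] as a Moebius transformation; clearing the denominator
    makes this a relation linear in the entries of [M]. *)
Definition mobius_maps (M : 'M[rat]_2) (x y : algC) :=
  y * (ratr (M 1 0) * x + ratr (M 1 1)) = ratr (M 0 0) * x + ratr (M 0 1).

(** The form vanishes at the image of [(x, 1)], and the second coordinate of that
    image is nonzero as [x] is irrational. *)
Lemma AutAbs_mobius_maps M x : AutAbs F M -> root (map_poly ratr p) x ->
  exists2 y, root (map_poly ratr p) y & mobius_maps M x y.
Proof.
move=> HM rx; have [eps Deps Hev] := AutAbs_hformC HM.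
have := Hev x 1; rewrite !mulr1 hformC_x1 (rootP rx) mulr0.
set u := _ + _; set w := ratr (M 1 0) * _ + _ => e0.
have w0 : w != 0.
  apply/eqP => w0; move: e0; rewrite w0 hformC_x0 (monicP mon_p) rmorph1 mul1r => /eqP.
  rewrite expf_eq0 => /andP[_ /eqP u0].
  have [] := @quadratic_relation_eq0 x (M 1 1) (M 1 0) 0 rx.
    by rewrite rmorph0 mul0r addr0 addrC.
  move=> m11 m10 _; have := AutAbs_unit HM.
  by rewrite mx2_unit m11 m10 !mulr0 subrr eqxx.
exists (u / w); last by rewrite /mobius_maps -/u -/w divfK.
move/eqP: e0; rewrite hformC_y // mulf_eq0 expf_eq0 (negPf w0) andbF.
by [].
Qed.

Lemma sign_of_exp (l : rat) : (ratr l ^+ d = 1 :> algC) \/ (ratr l ^+ d = -1 :> algC) ->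
  l = 1 \/ l = -1.
Proof.
move=> h; have /eqP : `|l| ^+ d = 1.
  have : ratr (`|l| ^+ d) = 1 :> algC.
    by rewrite -normrX ratr_norm rmorphXn /=; case: h => ->; rewrite ?normrN normr1.
  by move/eqP; rewrite fmorph_eq1 => /eqP.
rewrite pexpr_eq1 ?(ltn_trans _ d_gt2) // eqr_norml ler01 andbT.
by case/orP => /eqP; [left|right].
Qed.

Lemma scaled_Aut l A : AutAbs F A -> AutAbs F (l *: A) -> l = 1 \/ l = -1.
Proof.
case/AutAbs_hformC => e1 De1 H1 /AutAbs_hformC[e2 De2 H2].
have := H2 1 0; rewrite !mxE !rmorphM -![ratr l * _ * _]mulrA
  -![ratr l * _ + ratr l * _]mulrDr hformC_scale H1.
rewrite hformC_x0 (monicP mon_p) rmorph1 expr1n !mulr1 size_p /= => e.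
apply: sign_of_exp; case: De1 e => ->; case: De2 => ->; rewrite ?mulr1 ?mulrN1.
- by left.
- by right.
- by move/eqP; rewrite eqr_oppLR => /eqP; right.
- by move/oppr_inj; left.
Qed.

(** Equating the two expressions of [y] gives a rational quadratic equation for
    [x], which must be trivial.  Its coefficients say that the product of the
    adjugate of [A] with [M] is the scalar [l], so [M] is a multiple of [A]; the
    factor is 1 or -1 because the form is homogeneous of degree [d]. *)
Lemma mobius_maps_uniq A M x y : root (map_poly ratr p) x ->
  AutAbs F A -> AutAbs F M -> mobius_maps A x y -> mobius_maps M x y -> M = A \/ M = - A.
Proof.
move=> rx HA HM mA mM.
have := AutAbs_unit HA; rewrite mx2_unit; set D := _ - _ => D0.
pose l := A 1 1 * M 0 0 - A 0 1 * M 1 0.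
have e : (ratr (A 0 0) * x + ratr (A 0 1)) * (ratr (M 1 0) * x + ratr (M 1 1)) -
    (ratr (M 0 0) * x + ratr (M 0 1)) * (ratr (A 1 0) * x + ratr (A 1 1)) = 0.
  by rewrite -mA -mM; ring.
have [|e1 e2 e3] := @quadratic_relation_eq0 x (A 0 1 * M 1 1 - M 0 1 * A 1 1)
  (A 0 0 * M 1 1 + A 0 1 * M 1 0 - M 0 0 * A 1 1 - M 0 1 * A 1 0)
  (A 0 0 * M 1 0 - M 0 0 * A 1 0) rx.
  by rewrite -[RHS]e !(rmorphB, rmorphD, rmorphM) /=; ring.
have DM : M = (l / D) *: A.
  have k (u v : rat) : D * u = l * v -> u = l / D * v.
    by move=> h; apply: (mulfI D0); rewrite h mulrA mulrCA divff // mulr1.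
  have z0 (u v w : rat) : u - v = w -> w = 0 -> u = v.
    by move=> <- /eqP; rewrite subr_eq0 => /eqP.
  rewrite [LHS]mx2_eta [in RHS](mx2_eta A) mx2Z.
  congr mx2; apply: k.
  - apply: (@z0 _ _ (A 0 1 * (A 0 0 * M 1 0 - M 0 0 * A 1 0))); first by rewrite /D /l; ring.
    by rewrite e3 mulr0.
  - apply: (@z0 _ _ (A 0 1 * (A 0 0 * M 1 1 + A 0 1 * M 1 0 - M 0 0 * A 1 1 - M 0 1 * A 1 0)
       - A 0 0 * (A 0 1 * M 1 1 - M 0 1 * A 1 1))); first by rewrite /D /l; ring.
    by rewrite e1 e2 !mulr0 subrr.
  - apply: (@z0 _ _ (A 1 1 * (A 0 0 * M 1 0 - M 0 0 * A 1 0))); first by rewrite /D /l; ring.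
    by rewrite e3 mulr0.
  - apply: (@z0 _ _ (A 1 1 * (A 0 0 * M 1 1 + A 0 1 * M 1 0 - M 0 0 * A 1 1 - M 0 1 * A 1 0)
       - A 1 0 * (A 0 1 * M 1 1 - M 0 1 * A 1 1))); first by rewrite /D /l; ring.
    by rewrite e1 e2 !mulr0 subrr.
move: HM; rewrite DM => HM.
by have [->|->] := scaled_Aut HA HM; [left|right]; rewrite ?scale1r ?scaleN1r.
Qed.

End Automorphisms.

(** * Automorphisms of Psi_n for large n *)

Lemma totient_pfactor_leq n p e : (0 < n)%N -> prime p -> (p ^ e.+1 %| n)%N ->
  (p.-1 * p ^ e <= totient n)%N.
Proof.
move=> n_gt0 pp pe; have [m cpm Dn] := pfactor_coprime pp n_gt0.
have le_e : (e.+1 <= logn p n)%N by rewrite -pfactor_dvdn.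
have m_gt0 : (0 < m)%N by move: n_gt0; rewrite Dn muln_gt0 => /andP[].
rewrite [X in totient X]Dn totient_coprime; last by rewrite coprime_sym coprimeXl.
rewrite totient_pfactor ?(leq_trans _ le_e) //.
apply: leq_trans (leq_pmull _ _); last by rewrite totient_gt0.
by rewrite leq_mul2l leq_exp2l ?prime_gt1 //; apply/orP; right; lia.
Qed.

(** If [p^(e+1)] divides [n], the totient is at least [(p - 1) p^e].  So a totient
    below 6 bounds every prime power in [n], and [n] divides 120. *)
Lemma totient_ge6 n : (0 < n)%N -> n \notin [:: 1; 2; 3; 4; 5; 6; 8; 10; 12]%N ->
  (6 <= totient n)%N.
Proof.
move=> n_gt0; apply: contraNT; rewrite -ltnNge => lt6.
have : (n %| 120)%N.
  apply: dvdn_of_pfactors => // p [|e] pp pe; first by rewrite expn0 dvd1n.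
  have := totient_pfactor_leq n_gt0 pp pe.
  have := prime_ge7 pp => /or4P[/eqP e2|/eqP e3|/eqP e5|p6].
  - by rewrite e2; case: e {pe} => [|[|[|e]]] //; rewrite !expnS; have := expn_gt0 2 e; lia.
  - by rewrite e3; case: e {pe} => [|e] //; rewrite !expnS; have := expn_gt0 3 e; lia.
  - by rewrite e5; case: e {pe} => [|e] //; rewrite !expnS; have := expn_gt0 5 e; lia.
  - have q0 : (0 < p ^ e)%N by rewrite expn_gt0 prime_gt0.
    have p1 : (6 <= p.-1)%N by rewrite -ltnS prednK // prime_gt0.
    by rewrite leqNgt (leq_trans lt6) // -[6%N]muln1 leq_mul.
have /allP al : all (fun m => (6 <= totient m)%N ||
    (m \in [:: 1; 2; 3; 4; 5; 6; 8; 10; 12]%N)) (divisors 120) by vm_compute.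
by rewrite dvdn_divisors // => /al; rewrite leqNgt lt6.
Qed.

Lemma psi_min_form n p : (0 < n)%N -> is_psi n p -> (2 < totient n %/ 2)%N ->
  min_form p (totient n %/ 2).
Proof.
by move=> n0 psip d2; case: (psip) => mp sp _; split=> // r q; apply: (psi_size_root n0 psip).
Qed.

Lemma psi_unique n p q (z : algC) : n.-primitive_root z -> is_psi n p ->
  q \is monic -> size q = (totient n %/ 2).+1 ->
  root (map_poly ratr q) (z + z^-1) -> p = q.
Proof.
move=> prz psip mq sq rq; have n_gt0 := prim_order_gt0 prz.
have rp := psi_root psip prz; have [mp sp _] := psip.
apply/eqP; rewrite -subr_eq0; apply: contraT => d0.
have : root (map_poly ratr (p - q)) (z + z^-1).
  by rewrite rmorphB rootE hornerD hornerN (rootP rp) (rootP rq) subrr.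
by move=> /(psi_size_root n_gt0 psip rp) /(_ d0); rewrite leqNgt size_monic_sub // sp sq.
Qed.

Section Generic.
Variables (n : nat) (p : {poly rat}).
Hypotheses (psip : is_psi n p) (d_gt2 : (2 < totient n %/ 2)%N).
Let d := (totient n %/ 2)%N.
Let n_gt0 : (0 < n)%N.
Proof. by case: n d_gt2. Qed.
Let n_gt2 : (2 < n)%N.
Proof. by rewrite -totient_gt1; move: d_gt2; rewrite divn2; lia. Qed.
Let minp : min_form p d := psi_min_form n_gt0 psip d_gt2.

(** If [n] is odd, then [(- z)^n = - 1].  If [n = 2 m] with [m] odd, then
    [(- z)^m = - z^m = 1]. *)
Lemma prim_root_neq_opp (z w : algC) : ~~ (4 %| n)%N -> n.-primitive_root z ->
  n.-primitive_root w -> w != - z.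
Proof.
move=> n4 prz prw; apply/eqP => Dw.
have nexp m (y : algC) : n.-primitive_root y -> (0 < m < n)%N -> y ^+ m != 1.
  move=> pry /andP[m0 mn]; rewrite -(prim_order_dvd pry); apply/negP => /(dvdn_leq m0).
  by rewrite leqNgt mn.
have one : (-1 : algC) != 1 by rewrite eqNr oner_eq0.
have := prim_expr_order prw; rewrite Dw exprNn (prim_expr_order prz) mulr1.
rewrite -signr_odd; case: odd (odd_double_half n) => [_ /eqP|Dn _]; first by rewrite (negPf one).
move: Dn; rewrite add0n; set m := n./2 => Dn.
have m_lt : (0 < m < n)%N by rewrite -Dn; move: n_gt2; rewrite -Dn; lia.
have zm : z ^+ m = -1.
  have : (z ^+ m) ^+ 2 == 1 by rewrite -exprM muln2 Dn (prim_expr_order prz).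
  by rewrite sqrf_eq1 (negPf (nexp _ _ prz m_lt)) => /eqP.
have := nexp _ _ prw m_lt; rewrite Dw exprNn zm -signr_odd.
case: odd (odd_double_half m) => [_|Dm]; first by rewrite expr1 mulrN1 opprK eqxx.
by case/negP: n4; rewrite -Dn -Dm add0n -!muln2 -mulnA dvdn_mull.
Qed.

(** [w + 1/w = - (z + 1/z)] only if [w] is [- z] or [- 1/z]. *)
Lemma root_opp (z : algC) : ~~ (4 %| n)%N -> n.-primitive_root z ->
  ~~ root (map_poly ratr p) (- (z + z^-1)).
Proof.
move=> n4 prz; apply/negP => /(psi_rootP n_gt0 psip)[w prw e].
have z0 := prim_root_neq0 prz; have w0 := prim_root_neq0 prw.
have : (w + z) * (w * z + 1) == 0.
  have -> : (w + z) * (w * z + 1) = w * z * ((z + z^-1) + (w + w^-1)) by field; rewrite ?z0 ?w0.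
  by rewrite -e subrr mulr0.
rewrite mulf_eq0 => /orP[]; rewrite addr_eq0.
  by rewrite (negPf (prim_root_neq_opp n4 prz prw)).
have := prim_root_neq_opp n4 (prim_root_inv prz) prw => /eqP ne /eqP e2; apply: ne.
by apply: (mulIf z0); rewrite e2 mulNr mulVf.
Qed.

(** [M] is diagonal by [mobius_rel_trivial].  The values of the form at [(1, 0)]
    and [(0, 1)] are nonzero, so the two entries are 1 or -1.  If they differ, [M]
    maps a root to its opposite. *)
Lemma AutAbs_generic M : n \notin [:: 1; 2; 3; 4; 5; 6; 8; 10; 12]%N ->
  n \notin [:: 7; 9; 14; 15; 18; 24; 30]%N -> AutAbs (homogenize p) M ->
  exists s v, [/\ s = 1 \/ s = -1, v = 1 \/ v = -1, ~~ (4 %| n)%N -> s = v &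
    M = mx2 s 0 0 v].
Proof.
move=> nl1 nl2 HM; have [z prz] := C_prim_root_exists n_gt0.
have z0 := prim_root_neq0 prz.
have [y ry mM] := AutAbs_mobius_maps minp HM (psi_root psip prz).
have [w prw Dy] := psi_rootP n_gt0 psip ry.
have [k Dw] := prim_rootP prz (prim_expr_order prw).
have cok : coprime k n by rewrite -(prim_root_exp_coprime _ prz) -Dw.
have [t0 u0] : M 1 0 = 0 /\ - M 0 1 = 0.
  apply: (mobius_rel_trivial prz nl1 nl2 (k := k%:Z) (b := M 1 1) (c := - M 0 0)).
    move=> q pq qn; apply/negP => qk.
    have : (q %| gcdn k n)%N by rewrite dvdn_gcd qn andbT.
    by rewrite (eqP cok) dvdn1 => /eqP q1; rewrite q1 in pq.
  rewrite root_sum_mobius_rel // -exprnN -exprnP -Dw -Dy !rmorphN /=.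
  have e := mM; rewrite /mobius_maps in e.
  have -> : ratr (M 1 0) * (z + z^-1) * y + ratr (M 1 1) * y =
    y * (ratr (M 1 0) * (z + z^-1) + ratr (M 1 1)) by ring.
  by rewrite e; ring.
have {}u0 : M 0 1 = 0 by rewrite -[M 0 1]opprK u0 oppr0.
have [eps Deps Hev] := AutAbs_hformC HM.
have [mp sp _] := psip.
have Ds : M 0 0 = 1 \/ M 0 0 = -1.
  apply: (sign_of_exp minp).
  have := Hev 1 0; rewrite t0 u0 rmorph0 !mul0r !mulr0 !addr0 !hformC_x0 (monicP mp).
  by rewrite rmorph1 !mul1r expr1n !mulr1 sp /= => ->.
have Dv : M 1 1 = 1 \/ M 1 1 = -1.
  apply: (sign_of_exp minp).
  have p0 : hformC p 0 1 != 0.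
    apply/eqP; have := @hformC_rat_eq0 _ _ minp 0 1; rewrite rmorph0 rmorph1 => h /h[_].
    by move/eqP; rewrite oner_eq0.
  have := Hev 0 1; rewrite t0 u0 rmorph0 !mul0r !mulr0 !add0r.
  rewrite -{1}[0](mulr0 (ratr (M 1 1))) hformC_scale sp /= => /(mulIf p0) ->.
  exact: Deps.
exists (M 0 0), (M 1 1); split=> //; last by rewrite [LHS]mx2_eta t0 u0.
move=> n4; apply/eqP; apply: contraT => sv.
have Dsv : M 0 0 = - M 1 1.
  by case: Ds sv => ->; case: Dv => ->; rewrite ?eqxx ?opprK.
case/negP: (root_opp n4 prz); suff <- : y = - (z + z^-1) by [].
move: mM; rewrite /mobius_maps t0 u0 Dsv rmorph0 mul0r add0r addr0 rmorphN /= mulrC => e.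
have v0 : ratr (M 1 1) != 0 :> algC.
  by rewrite fmorph_eq0; case: Dv => ->; rewrite ?oppr_eq0 oner_eq0.
by apply: (mulfI v0); rewrite e mulNr mulrN.
Qed.

(** If 4 divides [n], then [- z = z^(1 + n/2)] is primitive, so Psi_n is stable
    under X -> - X up to the sign (-1)^d.  An odd degree would make 0 a root. *)
Lemma parity_form : (4 %| n)%N -> ~~ odd d /\
  form_act (homogenize p) (mx2 (-1) 0 0 1) = homogenize p.
Proof.
move=> n4; have [z prz] := C_prim_root_exists n_gt0.
have z0 := prim_root_neq0 prz; have [mp sp _] := psip.
have rp := psi_root psip prz.
have n2 : (n./2.*2 = n)%N by lia.
have zh : z ^+ n./2 = -1.
  have : (z ^+ n./2) ^+ 2 == 1 by rewrite -exprM muln2 n2 (prim_expr_order prz).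
  rewrite sqrf_eq1 -(prim_order_dvd prz) => /orP[/dvdn_leq|/eqP //].
  by rewrite -{2}n2; move: n_gt2; rewrite -{1}n2; lia.
have prmz : n.-primitive_root (- z).
  have -> : - z = z ^+ (n./2).+1 by rewrite exprS zh mulrN1.
  rewrite prim_root_exp_coprime //.
  have : coprime (n./2).+1 n./2 by rewrite coprime_sym coprimenS.
  have c2 : coprime (n./2).+1 2 by rewrite coprime_sym prime_coprime //; lia.
  by move=> c1; have := coprimeMr (n./2).+1 n./2 2; rewrite c1 c2 muln2 n2 => ->.
have rmp := psi_root psip prmz.
pose q := \poly_(i < d.+1) ((-1) ^+ (d - i) * p`_i).
have rq : root (map_poly ratr q) (z + z^-1).
  apply/rootP; rewrite (@horner_coef_wide _ d.+1) ?size_map_poly ?size_poly //.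
  transitivity ((-1) ^+ d * (map_poly ratr p).[- z + (- z)^-1]); last first.
    by rewrite (rootP rmp) mulr0.
  rewrite (@horner_coef_wide _ d.+1 (map_poly ratr p)) ?size_map_poly ?sp // mulr_sumr.
  apply: eq_bigr => i _; rewrite !coef_map coef_poly ltn_ord /= rmorphM rmorphXn rmorphN1 /=.
  rewrite invrN -opprD [(- (z + _)) ^+ _]exprNn.
  have -> : (-1) ^+ (d - i) = (-1) ^+ d * (-1) ^+ i :> algC.
    have le_i : (i <= d)%N by rewrite -ltnS.
    by move: (nat_of_ord i) le_i => j le_j;
      rewrite -{2}(subnK le_j) exprD -mulrA -expr2 sqrr_sign mulr1.
  by move: (ratr p`_i) ((z + z^-1) ^+ i) => u v; rewrite -!mulrA [X in _ = _ * X]mulrCA.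
have Dq : p = q.
  have sq : size q = d.+1.
    by apply: size_poly_eq; rewrite subnn mul1r; move/monicP: mp;
      rewrite lead_coefE sp /= => ->; rewrite oner_eq0.
  apply: (psi_unique prz psip) => //.
  rewrite monicE lead_coefE sq coef_poly ltnSn subnn mul1r.
  by move/monicP: mp; rewrite lead_coefE sp /= => ->.
have coef_p j : (j <= d)%N -> p`_j = (-1) ^+ (d - j) * p`_j.
  by move=> le_j; rewrite {1}Dq coef_poly ltnS le_j.
have p0 : p`_0 != 0.
  apply/eqP => p0; have := @hformC_rat_eq0 _ _ minp 0 1; rewrite rmorph0 rmorph1 hformC_x1.
  rewrite horner_coef0 coef_map p0 /= rmorph0 => /(_ erefl)[_] /eqP.
  by rewrite oner_eq0.
have ev_d : ~~ odd d.
  apply/negP => od; have /eqP := coef_p 0%N (leq0n _).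
  rewrite subn0 -signr_odd od expr1 mulN1r -addr_eq0 -mulr2n mulrn_eq0 /=.
  by rewrite (negPf p0).
split=> //; rewrite (form_act_diag minp) /homogenize [(size p).-1](congr1 predn sp) /=.
apply: eq_bigr => i _; congr (_ *: _).
have le_i : (i <= d)%N by rewrite -ltnS -sp.
rewrite expr1n mulr1 [in RHS]coef_p // mulrC; congr (_ * _).
by rewrite -[RHS]signr_odd oddB // (negPf ev_d) addFb signr_odd.
Qed.

End Generic.

(** * The explicit forms of degree 3 and 4 *)

(** The simplest cubics of Shanks, X^3 - a e X^2 - (a + 3) X - e with [e] equal to
    1 or -1.  The values [(-1, 1)], [(0, 1)], [(0, -1)] and [(-1, -1)] of [(a, e)]
    give Psi_n for [n] equal to 7, 18, 9 and 14. *)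
Definition cubic (a e : rat) : {poly rat} := Poly [:: - e; - (a + 3); - (a * e); 1].
(** Psi_15 for [e = 1] and Psi_30 for [e = -1]. *)
Definition quartic (e : rat) : {poly rat} := Poly [:: 1; 4 * e; - 4; - e; 1].
(** Psi_24. *)
Definition biquad : {poly rat} := Poly [:: 1; 0; - 4; 0; 1].

Lemma monic_Poly (s : seq rat) : last 0 s = 1 -> Poly s \is monic /\ size (Poly s) = size s.
Proof.
move=> l1; have sz : size (Poly s) = size s.
  by rewrite (PolyK (c := 0)) // l1 oner_eq0.
by split=> //; rewrite monicE lead_coefE sz coef_Poly nth_last l1.
Qed.

Section SmallForms.
Variables (R : comNzRingType) (c : {rmorphism rat -> R}) (x y : R).

Lemma hform_cubic a e : hform c (cubic a e) x y =
  x ^+ 3 - c a * c e * x ^+ 2 * y - (c a + 3) * x * y ^+ 2 - c e * y ^+ 3.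
Proof.
rewrite /hform.
have [_ ->] : cubic a e \is monic /\ size (cubic a e) = 4%N by apply: monic_Poly.
rewrite !big_ord_recl big_ord0 !coef_Poly /= /bump /=.
by rewrite !rmorphN rmorphD rmorphM rmorph_nat rmorph1 /=; ring.
Qed.

Lemma hform_quartic e : hform c (quartic e) x y =
  x ^+ 4 - c e * x ^+ 3 * y - 4 * x ^+ 2 * y ^+ 2 + 4 * c e * x * y ^+ 3 + y ^+ 4.
Proof.
rewrite /hform.
have [_ ->] : quartic e \is monic /\ size (quartic e) = 5%N by apply: monic_Poly.
rewrite !big_ord_recl big_ord0 !coef_Poly /= /bump /=.
by rewrite !rmorphN rmorphM rmorph_nat rmorph1 /=; ring.
Qed.

Lemma hform_biquad : hform c biquad x y = x ^+ 4 - 4 * x ^+ 2 * y ^+ 2 + y ^+ 4.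
Proof.
rewrite /hform.
have [_ ->] : biquad \is monic /\ size biquad = 5%N by apply: monic_Poly.
rewrite !big_ord_recl big_ord0 !coef_Poly /= /bump /=.
by rewrite !rmorphN rmorph_nat rmorph1 rmorph0 /=; ring.
Qed.

End SmallForms.

Section SmallFormInvariance.
Variables (R : comNzRingType) (c : {rmorphism rat -> R}) (x y : R).

Lemma hform_cubic_inv a e : e = 1 \/ e = -1 ->
  hform c (cubic a e) (c (-1) * x + c (- e) * y) (c e * x + c 0 * y) =
  hform c (cubic a e) x y.
Proof.
by rewrite !hform_cubic => -[->|->]; rewrite !rmorphN rmorph1 rmorph0; ring.
Qed.

Lemma hform_quartic_inv e : e = 1 \/ e = -1 ->
  hform c (quartic e) (c (- e) * x + c 2 * y) (c (-1) * x + c e * y) =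
  hform c (quartic e) x y.
Proof.
by rewrite !hform_quartic => -[->|->]; rewrite !rmorphN rmorph1 rmorph_nat; ring.
Qed.

Lemma hform_biquad_inv e : e = 1 \/ e = -1 ->
  hform c biquad (c 0 * x + c 1 * y) (c e * x + c 0 * y) = hform c biquad x y.
Proof.
by rewrite !hform_biquad => -[->|->]; rewrite ?rmorphN rmorph1 rmorph0; ring.
Qed.

End SmallFormInvariance.

Lemma cubic_horner a e (r : algC) : (map_poly ratr (cubic a e)).[r] =
  r ^+ 3 - ratr a * ratr e * r ^+ 2 - (ratr a + 3) * r - ratr e.
Proof.
by rewrite -hformC_x1 (hform_cubic (ratr : {rmorphism rat -> algC})); ring.
Qed.

Lemma quartic_horner e (r : algC) : (map_poly ratr (quartic e)).[r] =
  r ^+ 4 - ratr e * r ^+ 3 - 4 * r ^+ 2 + 4 * ratr e * r + 1.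
Proof.
by rewrite -hformC_x1 (hform_quartic (ratr : {rmorphism rat -> algC})); ring.
Qed.

Lemma biquad_horner (r : algC) : (map_poly ratr biquad).[r] = r ^+ 4 - 4 * r ^+ 2 + 1.
Proof.
by rewrite -hformC_x1 (hform_biquad (ratr : {rmorphism rat -> algC})); ring.
Qed.

(** The lemmas of this section multiply [z^d p(z + 1/z)], which is Phi_n(z), by
    nonzero numbers such as [z^3 - 1], chosen so that the product is a multiple of
    [z^m - 1] or [z^m + 1], which vanishes. *)
Section Roots.
Variables (n : nat) (z : algC).
Hypothesis prz : n.-primitive_root z.
Let z0 : z != 0 := prim_root_neq0 prz.

Lemma prim_exp_neq1 m : ~~ (n %| m)%N -> z ^+ m - 1 != 0.
Proof. by rewrite subr_eq0 -(prim_order_dvd prz). Qed.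

Lemma prim_exp_half m : (0 < m)%N -> n = m.*2 -> z ^+ m = -1.
Proof.
move=> m0 Dn; have : (z ^+ m) ^+ 2 == 1.
  by rewrite -exprM muln2 -Dn (prim_expr_order prz).
rewrite sqrf_eq1 -(prim_order_dvd prz) => /orP[/dvdn_leq|/eqP //].
by rewrite Dn; lia.
Qed.

Lemma prim_exp_neqN1 m : ~~ (n %| m.*2)%N -> z ^+ m + 1 != 0.
Proof.
move=> nm; rewrite addr_eq0; apply: contraNneq nm => e.
by rewrite (prim_order_dvd prz) -muln2 exprM e sqrrN expr1n.
Qed.

Lemma root_cubic7 : n = 7%N -> root (map_poly ratr (cubic (-1) 1)) (z + z^-1).
Proof.
move=> Dn; apply/rootP; rewrite cubic_horner rmorphN rmorph1.
have z1 : z ^+ 7 = 1 by rewrite -Dn (prim_expr_order prz).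
have c := @prim_exp_neq1 1; rewrite Dn expr1 in c.
apply: (mulfI (expf_neq0 3 z0)); apply: (mulfI (c isT)); rewrite !mulr0.
transitivity (z ^+ 7 - 1); last by rewrite z1 subrr.
by field; rewrite z0.
Qed.

Lemma root_cubic18 : n = 18%N -> root (map_poly ratr (cubic 0 1)) (z + z^-1).
Proof.
move=> Dn; apply/rootP; rewrite cubic_horner rmorph0 rmorph1.
have z1 : z ^+ 9 = -1 by apply: prim_exp_half.
have c := @prim_exp_neqN1 3; rewrite Dn in c.
apply: (mulfI (expf_neq0 3 z0)); apply: (mulfI (c isT)); rewrite !mulr0.
transitivity (z ^+ 9 + 1); last by rewrite z1 addNr.
by field; rewrite z0.
Qed.

Lemma root_cubic9 : n = 9%N -> root (map_poly ratr (cubic 0 (-1))) (z + z^-1).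
Proof.
move=> Dn; apply/rootP; rewrite cubic_horner rmorph0 rmorphN rmorph1.
have z1 : z ^+ 9 = 1 by rewrite -Dn (prim_expr_order prz).
have c := @prim_exp_neq1 3; rewrite Dn in c.
apply: (mulfI (expf_neq0 3 z0)); apply: (mulfI (c isT)); rewrite !mulr0.
transitivity (z ^+ 9 - 1); last by rewrite z1 subrr.
by field; rewrite z0.
Qed.

Lemma root_cubic14 : n = 14%N -> root (map_poly ratr (cubic (-1) (-1))) (z + z^-1).
Proof.
move=> Dn; apply/rootP; rewrite cubic_horner !rmorphN rmorph1.
have z1 : z ^+ 7 = -1 by apply: prim_exp_half.
have c := @prim_exp_neqN1 1; rewrite Dn expr1 in c.
apply: (mulfI (expf_neq0 3 z0)); apply: (mulfI (c isT)); rewrite !mulr0.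
transitivity (z ^+ 7 + 1); last by rewrite z1 addNr.
by field; rewrite z0.
Qed.

Lemma root_quartic15 : n = 15%N -> root (map_poly ratr (quartic 1)) (z + z^-1).
Proof.
move=> Dn; apply/rootP; rewrite quartic_horner rmorph1.
have z1 : z ^+ 15 = 1 by rewrite -Dn (prim_expr_order prz).
have c3 := @prim_exp_neq1 3; have c5 := @prim_exp_neq1 5; rewrite Dn in c3 c5.
apply: (mulfI (expf_neq0 4 z0)); apply: (mulfI (c5 isT)); apply: (mulfI (c3 isT)).
rewrite !mulr0; transitivity ((z ^+ 15 - 1) * (z - 1)); last by rewrite z1 subrr mul0r.
by field; rewrite z0.
Qed.

Lemma root_quartic30 : n = 30%N -> root (map_poly ratr (quartic (-1))) (z + z^-1).
Proof.
move=> Dn; apply/rootP; rewrite quartic_horner rmorphN rmorph1.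
have z1 : z ^+ 15 = -1 by apply: prim_exp_half.
have c3 := @prim_exp_neqN1 3; have c5 := @prim_exp_neqN1 5; rewrite Dn in c3 c5.
apply: (mulfI (expf_neq0 4 z0)); apply: (mulfI (c5 isT)); apply: (mulfI (c3 isT)).
rewrite !mulr0; transitivity ((z ^+ 15 + 1) * (z + 1)); last by rewrite z1 addNr mul0r.
by field; rewrite z0.
Qed.

Lemma root_biquad24 : n = 24%N -> root (map_poly ratr biquad) (z + z^-1).
Proof.
move=> Dn; apply/rootP; rewrite biquad_horner.
have z1 : z ^+ 12 = -1 by apply: prim_exp_half.
have c := @prim_exp_neqN1 4; rewrite Dn in c.
apply: (mulfI (expf_neq0 4 z0)); apply: (mulfI (c isT)); rewrite !mulr0.
transitivity (z ^+ 12 + 1); last by rewrite z1 addNr.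
by field; rewrite z0.
Qed.

End Roots.

Lemma linformE a b : linform a b = a%:MP * var_x + b%:MP * var_y.
Proof. by rewrite /linform !mul_mpolyC. Qed.

Lemma cubic_invariant a e : e = 1 \/ e = -1 ->
  form_act (homogenize (cubic a e)) (mx2 (-1) (- e) e 0) = homogenize (cubic a e).
Proof.
move=> De; rewrite form_act_hform homogenize_hform !mx2E !linformE.
exact: (hform_cubic_inv (@mpolyC 2 rat)).
Qed.

Lemma quartic_invariant e : e = 1 \/ e = -1 ->
  form_act (homogenize (quartic e)) (mx2 (- e) 2 (-1) e) = homogenize (quartic e).
Proof.
move=> De; rewrite form_act_hform homogenize_hform !mx2E !linformE.
exact: (hform_quartic_inv (@mpolyC 2 rat)).
Qed.

Lemma biquad_invariant e : e = 1 \/ e = -1 ->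
  form_act (homogenize biquad) (mx2 0 1 e 0) = homogenize biquad.
Proof.
move=> De; rewrite form_act_hform homogenize_hform !mx2E !linformE.
exact: (hform_biquad_inv (@mpolyC 2 rat)).
Qed.

Lemma min_form_root p d : min_form p d -> exists r : algC, root (map_poly ratr p) r.
Proof.
case=> _ sp d2 _; apply/closed_rootP; rewrite size_map_poly sp.
by case: d d2 {sp}.
Qed.

Lemma set1_unit (A : 'M[rat]_2) : A \in unitmx -> [set A] `<=` [set M | M \in unitmx].
Proof. by move=> uA _ ->. Qed.

Lemma conj_cyclic (P A B : 'M[rat]_2) : P \in unitmx -> B \in unitmx ->
  P *m A = B *m P -> conjugate_GL2 (generated [set A]) (generated [set B]).
Proof.
move=> uP uB e; exists P => //.
rewrite -[RHS]/([set conj_mx P M | M in generated [set B]]).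
rewrite conj_mx_generated //; last exact: set1_unit.
by rewrite image_set1 (conj_mx_eq uP e).
Qed.

Lemma mobius_mapsE M x y : mobius_maps M x y <->
  y * (ratr (M 1 0) * x + ratr (M 1 1)) = ratr (M 0 0) * x + ratr (M 0 1).
Proof. by []. Qed.

Section Cubic.
Variables (a e : rat).
Hypotheses (De : e = 1 \/ e = -1) (minp : min_form (cubic a e) 3).
Let F := homogenize (cubic a e).
Let A := mx2 (-1) (- e) e 0.

Let ee : e * e = 1. Proof. by case: De => ->. Qed.

Lemma cubic_sqr : A *m A = mx2 0 e (- e) (-1).
Proof. by rewrite mx2M !(mulNr, mulrN) ee; congr mx2; ring. Qed.

Lemma cubic_unit : A \in unitmx.
Proof. by rewrite mx2_unit !mx2E !mulNr ee mulr0 oppr0 add0r opprK oner_eq0. Qed.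

Lemma cubic_AutA : Aut F A.
Proof. exact: cubic_invariant. Qed.

(** The conjugates of a root [x] are its images under 1, [A] and [A^2].  Eliminating
    [a] between [p(x) = 0] and [p(y) = 0] leaves an equation that factors into the
    three Moebius relations. *)
Lemma cubic_AutAbsP M : AutAbs F M -> exists N,
  [/\ Aut F N, generated [set A] N & M = N \/ M = - N].
Proof.
move=> HM; have [x rx] := min_form_root minp.
have [_ A1 AM _] := generated_group (set1_unit cubic_unit).
have gA : generated [set A] A by apply: generated_in.
have [_ B1 BM _] := Aut_group minp.
have [y ry mM] := AutAbs_mobius_maps minp HM rx.
have uq N : Aut F N -> mobius_maps N x y -> M = N \/ M = - N.
  by move=> /Aut_AutAbs HN mN; apply: (mobius_maps_uniq minp rx HN HM mN mM).
have e2 : ratr e * ratr e = 1 :> algC by rewrite -rmorphM ee rmorph1.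
have : (y - x) * (y * x + ratr e * x + 1) * (y * x + ratr e * y + 1) == 0.
  move/rootP: rx; move/rootP: ry; rewrite !cubic_horner => ry rx.
  have -> : (y - x) * (y * x + ratr e * x + 1) * (y * x + ratr e * y + 1) =
    ratr e * ((y ^+ 3 - ratr a * ratr e * y ^+ 2 - (ratr a + 3) * y - ratr e) *
              (ratr e * x ^+ 2 + x) -
     (x ^+ 3 - ratr a * ratr e * x ^+ 2 - (ratr a + 3) * x - ratr e) *
              (ratr e * y ^+ 2 + y)).
    by case: De => ->; rewrite ?rmorphN rmorph1; ring.
  by rewrite ry rx !mul0r subrr mulr0.
rewrite !mulf_eq0 -orbA => /or3P[/eqP h|/eqP h|/eqP h].
- exists 1%:M; split=> //; apply: uq => //.
  rewrite mx2_1 mobius_mapsE !mx2E rmorph0 rmorph1 mul0r add0r mulr1 mul1r addr0.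
  by apply/eqP; rewrite -subr_eq0 h.
- exists A; split=> //; first exact: cubic_AutA; apply: uq; first exact: cubic_AutA.
  rewrite mobius_mapsE !mx2E rmorph0 !rmorphN rmorph1 addr0.
  apply/eqP; rewrite -subr_eq0; apply/eqP.
  transitivity (ratr e * (y * x + ratr e * x + 1) + (1 - ratr e * ratr e) * x).
    by ring.
  by rewrite h e2 subrr mulr0 mul0r addr0.
- have HAA : Aut F (A *m A) by apply: BM; apply: cubic_AutA.
  exists (A *m A); split=> //; first exact: AM.
  apply: uq => //; rewrite cubic_sqr mobius_mapsE !mx2E rmorph0 !rmorphN rmorph1 mul0r add0r.
  apply/eqP; rewrite -subr_eq0; apply/eqP.
  transitivity (- ratr e * (y * x + ratr e * y + 1) - (1 - ratr e * ratr e) * y).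
    by ring.
  by rewrite h e2 subrr mulr0 mul0r subr0.
Qed.

(** The degree is odd, so [- 1] is an automorphism only up to sign.  As [A] has order
    3, [- A] has order 6 and generates the group of [A] and [- 1]. *)
Lemma cubic_Aut :
  [/\ Aut F = generated [set A], conjugate_GL2 (Aut F) C3,
      AutAbs F = generated [set A; mx2 (-1) 0 0 (-1)] & conjugate_GL2 (AutAbs F) C6].
Proof.
have D1 : mx2 (-1) 0 0 (-1) = - 1%:M by rewrite mx2_1 mx2N oppr0.
have DA : Aut F = generated [set A].
  apply/seteqP; split; last first.
    by apply: generated_sub; [exact: Aut_group minp|move=> _ ->; apply: cubic_AutA].
  move=> M HM; have [N [HN gN [->//|DM]]] := cubic_AutAbsP (Aut_AutAbs HM).
  by move: HM; rewrite DM => /(Aut_odd_oppM minp isT HN).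
pose T := [set A; mx2 (-1) 0 0 (-1)].
have uT : T `<=` [set M | M \in unitmx].
  move=> _ [->|->]; first exact: cubic_unit.
  by rewrite /= D1 mx2_unitN unitmx1.
have [_ A1 AM _] := generated_group uT.
have DAbs : AutAbs F = generated T.
  apply/seteqP; split; last first.
    apply: generated_sub; first exact: AutAbs_group minp.
    move=> _ [->|->]; first by apply: Aut_AutAbs; apply: cubic_AutA.
    by rewrite D1; apply: AutAbs_opp1 minp.
  have sub : generated [set A] `<=` generated T.
    by apply: generated_sub; [exact: generated_group|move=> _ ->; apply: generated_in; left].
  move=> M /cubic_AutAbsP[N [_ /sub gN [->//|->]]].
  by rewrite -[N]mul1mx -mulNmx -D1; apply: AM => //; apply: generated_in; right.
have uP : mx2 0 e 1 0 \in unitmx.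
  by rewrite mx2_unit !mx2E; case: De => ->.
split=> //.
- rewrite DA; apply: (conj_cyclic uP); first by rewrite mx2_unit !mx2E.
  by rewrite /A !mx2M; case: De => ->; congr mx2; ring.
rewrite DAbs; have -> : generated T = generated [set - A].
  have uN : - A \in unitmx by rewrite mx2_unitN cubic_unit.
  have gN : generated [set - A] (- A) by apply: generated_in.
  have [_ N1 NM _] := generated_group (set1_unit uN).
  have A3 : A *m (A *m A) = 1%:M.
    by rewrite cubic_sqr mx2M mx2_1; case: De => ->; congr mx2; ring.
  have N3 : generated [set - A] (- 1%:M).
    have -> : - 1%:M = (- A) *m ((- A) *m (- A)).
      have -> : (- A) *m (- A) = A *m A by rewrite mulNmx mulmxN opprK.
      by rewrite mulNmx A3.
    by do 2?[apply: (NM) => //].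
  apply: generated_eq => //; first exact: set1_unit.
    move=> _ [->|->]; last by rewrite D1.
    have : generated [set - A] ((- 1%:M) *m (- A)) by apply: NM.
    by rewrite mulNmx mul1mx opprK.
  move=> _ ->; rewrite -[A]mul1mx -mulNmx -D1.
  by apply: AM; apply: generated_in; [right|left].
apply: (conj_cyclic uP); first by rewrite mx2_unit !mx2E.
by rewrite /A mx2N !mx2M; case: De => ->; congr mx2; ring.
Qed.

End Cubic.

Lemma generated_opp (S : set 'M[rat]_2) M : S `<=` [set N | N \in unitmx] ->
  generated S (- 1%:M) -> generated S M -> generated S (- M).
Proof.
move=> uS h hM; have [_ _ SM _] := generated_group uS.
by rewrite -[M]mul1mx -mulNmx; apply: SM.
Qed.

Section Quartic.
Variables (e : rat).
Hypotheses (De : e = 1 \/ e = -1) (minp : min_form (quartic e) 4).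
Let F := homogenize (quartic e).
Let A := mx2 (- e) 2 (-1) e.

Lemma quartic_sqr : A *m A = - 1%:M.
Proof. by rewrite mx2M mx2_1 mx2N; case: De => ->; congr mx2; ring. Qed.

Lemma quartic_unit : A \in unitmx.
Proof. by rewrite mx2_unit !mx2E; case: De => ->. Qed.

Lemma quartic_AutA : Aut F A.
Proof. exact: quartic_invariant. Qed.

(** The conjugates of a root [x] are [x], its image under [A], [s = e (x^2 - 2)] and the
    image of [s] under [A].  A matrix that maps [x] to one of the last two would give
    a rational cubic equation for [x]. *)
Lemma quartic_AutAbs_sub : AutAbs F `<=` generated [set A].
Proof.
move=> M HM; have [x rx] := min_form_root minp.
have uA := set1_unit quartic_unit.
have [_ A1 AM _] := generated_group uA.
have gA : generated [set A] A by apply: generated_in.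
have gN N : generated [set A] N -> generated [set A] (- N).
  by apply: generated_opp => //; rewrite -quartic_sqr; apply: AM.
have [y ry mM] := AutAbs_mobius_maps minp HM rx.
have uq N : Aut F N -> generated [set A] N -> mobius_maps N x y -> generated [set A] M.
  move=> /Aut_AutAbs HN hN mN.
  by have [->|->] := mobius_maps_uniq minp rx HN HM mN mM; [|apply: gN].
have nz : M 1 0 = 0 -> M 1 1 = 0 -> False.
  by move=> m10 m11; have := AutAbs_unit minp HM; rewrite mx2_unit m10 m11 !mulr0 subrr eqxx.
pose s : algC := ratr e * (x ^+ 2 - 2).
have : (y - x) * (y * x - ratr e * y - ratr e * x + 2) * (y - s)
       * (y * s - ratr e * y - ratr e * s + 2) == 0.
  move/rootP: rx; move/rootP: ry; rewrite !quartic_horner => ry rx.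
  (* The last factor on the right is the quotient of a polynomial division by p(x)
     of the difference between the left side and the first term on the right. *)
  have -> : (y - x) * (y * x - ratr e * y - ratr e * x + 2) * (y - s)
       * (y * s - ratr e * y - ratr e * s + 2) =
    (y ^+ 4 - ratr e * y ^+ 3 - 4 * y ^+ 2 + 4 * ratr e * y + 1) *
      ((x - ratr e) * (s - ratr e)) +
    (x ^+ 4 - ratr e * x ^+ 3 - 4 * x ^+ 2 + 4 * ratr e * x + 1) *
    (x ^+ 2 * y ^+ 2 - 2 * ratr e * x ^+ 2 * y + x ^+ 2 - x * y ^+ 3
     + 2 * ratr e * x * y ^+ 2 - ratr e * x + 4 * ratr e * y - 3 - ratr e * y ^+ 3).
    by rewrite /s; case: De => ->; rewrite ?rmorphN rmorph1; ring.
  by rewrite ry rx !mul0r addr0.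
rewrite !mulf_eq0 -!orbA => /or4P[/eqP h|/eqP h|/eqP h|/eqP h].
- apply: (uq 1%:M) => //; first by have [_ ? _ _] := Aut_group minp.
  rewrite mx2_1 mobius_mapsE !mx2E rmorph0 rmorph1 mul0r add0r mulr1 mul1r addr0.
  by apply/eqP; rewrite -subr_eq0 h.
- apply: (uq A) => //; first exact: quartic_AutA.
  rewrite mobius_mapsE !mx2E !rmorphN rmorph1 rmorph_nat.
  apply/eqP; rewrite -subr_eq0; apply/eqP; rewrite -[RHS]oppr0 -h; ring.
- have ys : y = s by apply/eqP; rewrite -subr_eq0 h.
  have [|m4 m3 m2 m1] := @cubic_relation_eq0 _ _ minp x (- 2 * e * M 1 1 - M 0 1)
    (- 2 * e * M 1 0 - M 0 0) (e * M 1 1) (e * M 1 0) rx isT.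
    have := mM; rewrite mobius_mapsE ys /s => /eqP; rewrite -subr_eq0 => /eqP <-.
    by rewrite !(rmorphB, rmorphM, rmorphN) rmorph_nat; ring.
  have e0 : e != 0 by case: De => ->.
  have [] := nz; apply: (mulfI e0); first by rewrite m1 mulr0.
  by rewrite m2 mulr0.
have [|m4 m3 m2 m1] := @cubic_relation_eq0 _ _ minp x (- 4 * M 1 1 + 3 * e * M 0 1)
    (- 4 * M 1 0 + 3 * e * M 0 0) (M 1 1 - e * M 0 1) (M 1 0 - e * M 0 0) rx isT.
  transitivity ((ratr e * s - 2) * (ratr (M 1 0) * x + ratr (M 1 1)) -
      (s - ratr e) * (y * (ratr (M 1 0) * x + ratr (M 1 1))) ).
    rewrite ((mobius_mapsE _ _ _).1 mM).
    by rewrite /s; case: De => ->; rewrite ?rmorphN rmorph1; ring.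
  transitivity (- (y * s - ratr e * y - ratr e * s + 2) * (ratr (M 1 0) * x + ratr (M 1 1))).
    by ring.
  by rewrite h oppr0 mul0r.
have [] := nz; by case: De m1 m2 m3 m4 => ->; lra.
Qed.

Lemma quartic_Aut :
  [/\ Aut F = AutAbs F, AutAbs F = generated [set A] & conjugate_GL2 (AutAbs F) C4].
Proof.
have sub : generated [set A] `<=` Aut F.
  by apply: generated_sub; [exact: Aut_group minp|move=> _ ->; apply: quartic_AutA].
have DAbs : AutAbs F = generated [set A].
  by apply/seteqP; split=> [|M /sub/Aut_AutAbs //]; exact: quartic_AutAbs_sub.
split=> //.
  by apply/seteqP; split=> [|M]; [exact: Aut_AutAbs|rewrite DAbs => /sub].
rewrite DAbs; apply: (@conj_cyclic (mx2 1 0 (- e) 2)).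
- by rewrite mx2_unit !mx2E; case: De => ->.
- by rewrite mx2_unit !mx2E.
- by rewrite /A !mx2M; case: De => ->; congr mx2; ring.
Qed.

End Quartic.

Section Biquad.
Hypothesis minp : min_form biquad 4.
Let F := homogenize biquad.
Let S := mx2 0 1 1 0.
Let J := mx2 0 1 (-1) 0.

(** The conjugates of a root [x] are [x], [- x], [1/x] and [- 1/x]; the second one comes from
    the product of [S] and [J], and the square of [J] is [- 1]. *)
Lemma biquad_Aut :
  [/\ Aut F = AutAbs F, AutAbs F = generated [set S; J] & AutAbs F = D4].
Proof.
pose T := [set S; J].
have uT : T `<=` [set M | M \in unitmx].
  by move=> _ [->|->]; rewrite /= mx2_unit !mx2E.
have AT : T `<=` Aut F by move=> _ [->|->]; apply: biquad_invariant; [left|right].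
have sub : generated T `<=` Aut F.
  by apply: generated_sub => //; exact: Aut_group minp.
have [_ T1 TM _] := generated_group uT.
have gS : generated T S by apply: generated_in; left.
have gJ : generated T J by apply: generated_in; right.
have gN N : generated T N -> generated T (- N).
  apply: generated_opp => //; have -> : - 1%:M = J *m J; last exact: TM.
  by rewrite mx2M mx2_1 mx2N; congr mx2; ring.
have DAbs : AutAbs F = generated T; last first.
  split=> //; apply/seteqP; split=> [|M]; [exact: Aut_AutAbs|].
  by rewrite DAbs => /sub.
apply/seteqP; split=> [M HM|M /sub/Aut_AutAbs //].
have [x rx] := min_form_root minp.
have [y ry mM] := AutAbs_mobius_maps minp HM rx.
have uq N : generated T N -> mobius_maps N x y -> generated T M.
  move=> gNN mN; have /sub/Aut_AutAbs HN := gNN.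
  by have [->|->] := mobius_maps_uniq minp rx HN HM mN mM; [|apply: gN].
have : (y - x) * (y + x) * (y * x - 1) * (y * x + 1) == 0.
  move/rootP: rx; move/rootP: ry; rewrite !biquad_horner => ry rx.
  have -> : (y - x) * (y + x) * (y * x - 1) * (y * x + 1) =
    (y ^+ 4 - 4 * y ^+ 2 + 1) * x ^+ 2 - (x ^+ 4 - 4 * x ^+ 2 + 1) * y ^+ 2 by ring.
  by rewrite ry rx !mul0r subr0.
rewrite !mulf_eq0 -!orbA => /or4P[/eqP h|/eqP h|/eqP h|/eqP h].
- apply: (uq 1%:M) => //; rewrite mx2_1 mobius_mapsE !mx2E rmorph0 rmorph1.
  apply/eqP; rewrite -subr_eq0; apply/eqP; transitivity (y - x); last by [].
  by ring.
- apply: (uq (S *m J)); first exact: TM.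
  rewrite mx2M mobius_mapsE !mx2E !(mul0r, mulr0, mulr1, mul1r, add0r, addr0).
  rewrite rmorph0 rmorphN rmorph1.
  apply/eqP; rewrite -subr_eq0; apply/eqP; transitivity (y + x); last by [].
  by ring.
- apply: (uq S) => //; rewrite mobius_mapsE !mx2E rmorph0 rmorph1.
  apply/eqP; rewrite -subr_eq0; apply/eqP; transitivity (y * x - 1); last by [].
  by ring.
- apply: (uq J) => //; rewrite mobius_mapsE !mx2E rmorph0 rmorphN rmorph1.
  apply/eqP; rewrite -subr_eq0; apply/eqP; transitivity (- (y * x + 1)).
    by ring.
  by rewrite h oppr0.
Qed.

End Biquad.

(** * The automorphism groups of Psi_n *)

Section GenericForms.
Variables (n : nat) (p : {poly rat}).
Hypotheses (psip : is_psi n p) (d_gt2 : (2 < totient n %/ 2)%N).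
Hypotheses (nl1 : n \notin [:: 1; 2; 3; 4; 5; 6; 8; 10; 12]%N)
  (nl2 : n \notin [:: 7; 9; 14; 15; 18; 24; 30]%N).
Let d := (totient n %/ 2)%N.
Let n_gt0 : (0 < n)%N. Proof. by case: n d_gt2. Qed.
Let minp : min_form p d := psi_min_form n_gt0 psip d_gt2.
Let F := homogenize p.

Lemma AutAbs_pm1 : ~~ (4 %| n)%N -> AutAbs F = [set 1%:M; - 1%:M].
Proof.
move=> n4; apply/seteqP; split=> M; last first.
  by case=> ->; [have [] := AutAbs_group minp|exact: AutAbs_opp1 minp].
move=> /(AutAbs_generic psip d_gt2 nl1 nl2)[s [v [Ds _ sv ->]]].
rewrite -(sv n4) mx2_1 mx2N oppr0.
by case: Ds => ->; [left|right].
Qed.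

(** The degree is even if 4 divides [n], by [parity_form]. *)
Lemma Aut_odd : odd d -> Aut F = [set 1%:M] /\ AutAbs F = [set 1%:M; - 1%:M].
Proof.
move=> od; have n4 : ~~ (4 %| n)%N.
  by apply/negP => /(parity_form psip d_gt2)[]; rewrite od.
have DAbs := AutAbs_pm1 n4; split=> //.
have [_ A1 _ _] := Aut_group minp.
apply/seteqP; split=> M; last by move=> ->.
move=> HM; have := Aut_AutAbs HM; rewrite DAbs => -[//|DM].
by move: HM; rewrite DM => /(Aut_odd_oppM minp od A1).
Qed.

Lemma Aut_even : ~~ odd d -> ~~ (4 %| n)%N ->
  Aut F = AutAbs F /\ AutAbs F = [set 1%:M; - 1%:M].
Proof.
move=> ev_d n4; have DAbs := AutAbs_pm1 n4; split=> //.
have [_ A1 _ _] := Aut_group minp.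
apply/seteqP; split=> M; first exact: Aut_AutAbs.
by rewrite DAbs => -[->|->] //; apply: Aut_even_oppM minp _ ev_d A1.
Qed.

Let T := [set mx2 (-1) 0 0 1; mx2 1 0 0 (-1)].

Lemma diag_unit : T `<=` [set M | M \in unitmx].
Proof. by move=> _ [->|->]; rewrite /= mx2_unit !mx2E. Qed.

(** The matrix [(1, 1; 1, -1)] diagonalizes the generators of [D2]. *)
Lemma Aut_four : (4 %| n)%N -> [/\ Aut F = AutAbs F, AutAbs F = generated T &
  isomorphic (AutAbs F) D2].
Proof.
move=> n4; have [ev_d HD] := parity_form psip d_gt2 n4.
have [_ T1 TM _] := generated_group diag_unit.
have gD : generated T (mx2 (-1) 0 0 1) by apply: generated_in; left.
have gD' : generated T (mx2 1 0 0 (-1)) by apply: generated_in; right.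
have mD : mx2 1 0 0 (-1) = - mx2 (-1) 0 0 1 by rewrite mx2N opprK oppr0.
have sub : generated T `<=` Aut F.
  apply: generated_sub; first exact: Aut_group minp.
  by move=> _ [->|->] //; rewrite mD; apply: (Aut_even_oppM minp ev_d).
have DAbs : AutAbs F = generated T.
  apply/seteqP; split=> [M|M /sub/Aut_AutAbs //].
  move=> /(AutAbs_generic psip d_gt2 nl1 nl2)[s [v [Ds Dv _ ->]]].
  case: Ds Dv => -> [] -> //; first by rewrite -mx2_1.
  have -> : mx2 (-1) 0 0 (-1) = mx2 (-1) 0 0 1 *m mx2 1 0 0 (-1).
    by rewrite mx2M; congr mx2; ring.
  exact: TM.
split=> //.
  by apply/seteqP; split=> [|M]; [exact: Aut_AutAbs|rewrite DAbs => /sub].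
rewrite DAbs; pose P := mx2 1 1 1 (-1); pose U := [set mx2 0 1 1 0; mx2 (-1) 0 0 (-1)].
have uP : P \in unitmx by rewrite mx2_unit !mx2E.
have uU : U `<=` [set M | M \in unitmx] by move=> _ [->|->]; rewrite /= mx2_unit !mx2E.
suff -> : generated T = [set conj_mx P M | M in generated U] by apply: conj_mx_isomorphic.
have cS : conj_mx P (mx2 0 1 1 0) = mx2 1 0 0 (-1).
  by apply: conj_mx_eq => //; rewrite !mx2M; congr mx2; ring.
have cN : conj_mx P (mx2 (-1) 0 0 (-1)) = mx2 (-1) 0 0 (-1).
  by apply: conj_mx_eq => //; rewrite !mx2M; congr mx2; ring.
rewrite conj_mx_generated //.
have uV : [set conj_mx P M | M in U] `<=` [set M | M \in unitmx].
  by move=> _ [M UM <-] /=; rewrite conj_mx_unit //; apply: uU.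
have [_ V1 VM _] := generated_group uV.
have gS : generated [set conj_mx P M | M in U] (mx2 1 0 0 (-1)).
  by rewrite -cS; apply: generated_in; exists (mx2 0 1 1 0) => //; left.
have gN : generated [set conj_mx P M | M in U] (mx2 (-1) 0 0 (-1)).
  by rewrite -cN; apply: generated_in; exists (mx2 (-1) 0 0 (-1)) => //; right.
apply: generated_eq => //; first exact: diag_unit.
- move=> _ [->|->] //.
  have -> : mx2 (-1) 0 0 1 = mx2 1 0 0 (-1) *m mx2 (-1) 0 0 (-1).
    by rewrite mx2M; congr mx2; ring.
  exact: VM.
- move=> _ [_ [->|->] <-]; rewrite ?cS ?cN //.
  have -> : mx2 (-1) 0 0 (-1) = mx2 (-1) 0 0 1 *m mx2 1 0 0 (-1).
    by rewrite mx2M; congr mx2; ring.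
  exact: TM.
Qed.

End GenericForms.

Section PsiSmall.
Variables (R : realType) (n : nat) (q : {poly rat}) (d : nat).
Hypotheses (n_gt2 : (2 < n)%N) (Dd : (totient n %/ 2)%N = d) (d_gt2 : (2 < d)%N).
Hypotheses (mon_q : q \is monic /\ size q = d.+1)
  (root_q : forall z : algC, n.-primitive_root z -> root (map_poly ratr q) (z + z^-1)).

Lemma PsiForm_eq : min_form q d /\ PsiForm R n = homogenize q.
Proof.
have n_gt0 : (0 < n)%N by apply: ltn_trans n_gt2.
have psip := is_psi_Psi R n_gt2; have [z prz] := C_prim_root_exists n_gt0.
have Dq : Psi R n = q by apply: (psi_unique prz psip); rewrite ?Dd; [case: mon_q..|exact: root_q].
split; last by rewrite /PsiForm Dq.
by rewrite -Dq -Dd; apply: psi_min_form => //; rewrite Dd.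
Qed.

End PsiSmall.

Unset Implicit Arguments.

Theorem theorem1p1 (R : realType) (n : nat) (hn0 : (0 < n)%N)
    (hn : n \notin [:: 1; 2; 3; 4; 5; 6; 8; 10; 12]%N) :
  let d := (totient n %/ 2)%N in
  let F := PsiForm R n in
  (size (Psi R n) = d.+1 /\ (3 <= d)%N)
  /\
  ((5 <= d)%N -> odd d ->
     [/\ Aut F = [set 1%:M], isomorphic (Aut F) C1,
         AutAbs F = [set 1%:M; - 1%:M] & isomorphic (AutAbs F) C2])
  /\
  ((6 <= d)%N -> ~~ odd d -> n <> 0 %[mod 4] ->
     [/\ Aut F = AutAbs F, AutAbs F = [set 1%:M; - 1%:M]
       & isomorphic (AutAbs F) C2])
  /\
  (n = 0 %[mod 4] -> n <> 24%N ->
     [/\ Aut F = AutAbs F,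
         AutAbs F = generated [set mx2 (-1) 0 0 1; mx2 1 0 0 (-1)]
       & isomorphic (AutAbs F) D2])
  /\
  (n \in [:: 7; 9; 14; 15; 18; 24; 30]%N ->
     (n \in [:: 7; 18]%N ->
        [/\ Aut F = generated [set mx2 (-1) (-1) 1 0],
            conjugate_GL2 (Aut F) C3,
            AutAbs F = generated [set mx2 (-1) (-1) 1 0; mx2 (-1) 0 0 (-1)]
          & conjugate_GL2 (AutAbs F) C6])
     /\
     (n \in [:: 9; 14]%N ->
        [/\ Aut F = generated [set mx2 (-1) 1 (-1) 0],
            conjugate_GL2 (Aut F) C3,
            AutAbs F = generated [set mx2 (-1) 1 (-1) 0; mx2 (-1) 0 0 (-1)]
          & conjugate_GL2 (AutAbs F) C6])
     /\
     (n = 15%N ->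
        [/\ Aut F = AutAbs F,
            AutAbs F = generated [set mx2 (-1) 2 (-1) 1]
          & conjugate_GL2 (AutAbs F) C4])
     /\
     (n = 24%N ->
        [/\ Aut F = AutAbs F,
            AutAbs F = generated [set mx2 0 1 1 0; mx2 0 1 (-1) 0]
          & AutAbs F = D4])
     /\
     (n = 30%N ->
        [/\ Aut F = AutAbs F,
            AutAbs F = generated [set mx2 1 2 (-1) (-1)]
          & conjugate_GL2 (AutAbs F) C4])).
Proof.
move=> d F.
have d_gt2 : (2 < d)%N by rewrite /d divn2; have := totient_ge6 hn0 hn; lia.
have n_gt2 : (2 < n)%N by rewrite -totient_gt1; have := totient_ge6 hn0 hn; lia.
have psip := is_psi_Psi R n_gt2.
have mod4 : (n = 0 %[mod 4]) <-> (4 %| n)%N.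
  by rewrite /dvdn mod0n; split=> [->|/eqP].
have small (P : pred nat) : ~~ has P [:: 7; 9; 14; 15; 18; 24; 30]%N -> P n ->
    n \notin [:: 7; 9; 14; 15; 18; 24; 30]%N.
  by move=> /hasPn H Pn; apply/negP => /H; rewrite Pn.
split; first by have [_ ->] := psip.
split.
  move=> d5 od; have nl2 : n \notin [:: 7; 9; 14; 15; 18; 24; 30]%N.
    by apply: (small (fun m => (4 < totient m %/ 2)%N)) => //; vm_compute.
  have [D1 D2] := Aut_odd psip d_gt2 hn nl2 od.
  by split=> //; rewrite ?D1 ?D2; apply: isomorphic_refl.
split.
  move=> d6 ev_d n4; have nl2 : n \notin [:: 7; 9; 14; 15; 18; 24; 30]%N.
    by apply: (small (fun m => (5 < totient m %/ 2)%N)) => //; vm_compute.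
  have n4' : ~~ (4 %| n)%N by apply/negP => /mod4.
  have [D1 D2] := Aut_even psip d_gt2 hn nl2 ev_d n4'.
  by split=> //; rewrite ?D2; apply: isomorphic_refl.
split.
  move=> /mod4 n4 n24; have nl2 : n \notin [:: 7; 9; 14; 15; 18; 24; 30]%N.
    apply: (small (fun m => (4 %| m)%N && (m != 24%N))) => //.
    by rewrite n4; apply/eqP.
  exact: Aut_four psip d_gt2 hn nl2 n4.
move=> _.
have cub a e : (totient n %/ 2)%N = 3%N -> e = 1 \/ e = -1 ->
    (forall z : algC, n.-primitive_root z -> root (map_poly ratr (cubic a e)) (z + z^-1)) ->
    [/\ Aut F = generated [set mx2 (-1) (- e) e 0], conjugate_GL2 (Aut F) C3,
      AutAbs F = generated [set mx2 (-1) (- e) e 0; mx2 (-1) 0 0 (-1)]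
      & conjugate_GL2 (AutAbs F) C6].
  move=> Dd De rt.
  have mq : cubic a e \is monic /\ size (cubic a e) = 4%N by exact: monic_Poly.
  have [m Dq] := PsiForm_eq R n_gt2 Dd isT mq rt.
  by rewrite /F Dq; apply: cubic_Aut.
have quart e : (totient n %/ 2)%N = 4%N -> e = 1 \/ e = -1 ->
    (forall z : algC, n.-primitive_root z -> root (map_poly ratr (quartic e)) (z + z^-1)) ->
    [/\ Aut F = AutAbs F, AutAbs F = generated [set mx2 (- e) 2 (-1) e]
      & conjugate_GL2 (AutAbs F) C4].
  move=> Dd De rt.
  have mq : quartic e \is monic /\ size (quartic e) = 5%N by exact: monic_Poly.
  have [m Dq] := PsiForm_eq R n_gt2 Dd isT mq rt.
  by rewrite /F Dq; apply: quartic_Aut.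
split.
  rewrite !inE => /orP[] /eqP Dn.
    by apply: (cub (-1) 1) => //; [rewrite Dn|left|move=> z prz; apply: root_cubic7 prz Dn].
  by apply: (cub 0 1) => //; [rewrite Dn|left|move=> z prz; apply: root_cubic18 prz Dn].
split.
  (* For e = -1 the entry - e of the generator is - (-1). *)
  rewrite !inE -[X in mx2 (-1) X]opprK => /orP[] /eqP Dn.
    by apply: (cub 0 (-1)) => //; [rewrite Dn|right|move=> z prz; apply: root_cubic9 prz Dn].
  by apply: (cub (-1) (-1)) => //; [rewrite Dn|right|move=> z prz; apply: root_cubic14 prz Dn].
split.
  move=> Dn; apply: (quart 1) => //; [by rewrite Dn|by left|].
  by move=> z prz; apply: root_quartic15 prz Dn.
split.
  move=> Dn; have Dd : (totient n %/ 2)%N = 4%N by rewrite Dn.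
  have mq : biquad \is monic /\ size biquad = 5%N by exact: monic_Poly.
  have [m Dq] := PsiForm_eq R n_gt2 Dd isT mq (fun z prz => root_biquad24 prz Dn).
  by rewrite /F Dq; apply: biquad_Aut.
move=> Dn; rewrite -[X in mx2 X]opprK; apply: (quart (-1)) => //; [by rewrite Dn|by right|].
by move=> z prz; apply: root_quartic30 prz Dn.
Qed.
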